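(* Let $k\ge 1$ and $t\ge 2$ be integers and let $v$ be a positive integer with $v\equiv 0\pmod{4kt}$. Then $(\alpha,\beta)\in\mathrm{HWP}(v;4k,4kt)$ if and only if $\alpha,\beta$ are non-negative integers with $\alpha+\beta=\frac{v-2}{2}$.
   Context: $K_v$ is the complete graph on $v$ vertices. A $1$-factor is a perfect matching. A $2$-factor of a graph $H$ is a spanning $2$-regular subgraph. A $C_k$-factor of $H$ is a $2$-factor all of whose components are cycles of length $k$ (equivalently, a set of vertex-disjoint $k$-cycles of $H$ covering all vertices). A $2$-factorization of $H$ is a partition of the edge set $E(H)$ into (edge sets of) $2$-factors. For $v$ even, $\mathrm{HWP}(v;m,n)$ denotes the set of pairs $(\alpha,\beta)$ of non-negative integers for which $K_v$ minus (the edges of) a $1$-factor has a $2$-factorization consisting of exactly $\alpha$ $C_m$-factors and $\beta$ $C_n$-factors (so $\alpha+\beta$ $2$-factors in total). *)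

(* Defs.v *)
From mathcomp Require Import all_boot.

Set Implicit Arguments.
Unset Strict Implicit.
Unset Printing Implicit Defensive.

(* A simple graph on the vertex type T is represented by its edge set, a set   *)
(* of two-element subsets of T.                                                *)

Section Factors.
Variable T : finType.
Implicit Types (H F C : {set {set T}}) (x y : T).

Definition complete_graph : {set {set T}} := [set e : {set T} | #|e| == 2].

Definition degree F x : nat := #|[set e in F | x \in e]|.

Definition spanning_regular (r : nat) H F : Prop :=
  F \subset H /\ forall x, degree F x = r.

Definition one_factor H F : Prop := spanning_regular 1 H F.

Definition two_factor H F : Prop := spanning_regular 2 H F.

Definition adjacent F : rel T := fun x y => [set x; y] \in F.

Definition component F x : {set {set T}} :=
  [set e in F | e \subset [set y | connect (adjacent F) x y]].

Definition cycle_graph (k : nat) C : Prop :=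
  exists p : seq T,
    [/\ 2 < k, size p = k, uniq p & C = [set [set x; next p x] | x in p]].

Definition C_factor (k : nat) H F : Prop :=
  two_factor H F /\ forall x, cycle_graph k (component F x).

(* The factors are sorted into two disjoint classes instead of being counted   *)
(* by type, so that the definition is also the intended one when m = n.        *)
Definition has_two_factorization H (m n alpha beta : nat) : Prop :=
  exists A B : {set {set {set T}}},
    [/\ [disjoint A & B], partition (A :|: B) H,
        #|A| = alpha /\ #|B| = beta,
        (forall F, F \in A -> C_factor m H F)
      & (forall F, F \in B -> C_factor n H F)].

End Factors.

Definition HWP (v m n : nat) (ab : nat * nat) : Prop :=
  exists I : {set {set 'I_v}},
    one_factor (complete_graph 'I_v) I /\
    has_two_factorization (complete_graph 'I_v :\: I) m n ab.1 ab.2.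

(* Main.v *)
Require Import Defs.
From mathcomp Require Import all_boot zify.

(** Necessity is a degree count ([HWP_count]): every vertex of K_v has degree v - 1, the 1-factor
takes one edge at it and each 2-factor takes two.

For sufficiency put v = 4 w, m = 4 k and n = 4 k t, so that k t divides w. The vertices are two
copies of 2 w positions, written (i, e) with i < 2 w and e a boolean, and the graph K_{2w} on
the positions is blown up: an edge i i' of it carries the four edges (i, e)(i', e'), and each
position carries one vertical edge. The round-robin 1-factorization of K_{2w} pairs its colours
c and c + 1 into Hamilton cycles; three colours, -1, 0 and 1, are kept apart.

(1) A Hamilton cycle blown up splits into two C_{2r}-factors for every even r dividing its
length ([blow_chart], [blow_near]; this is Haggkvist's doubling lemma). So each ordinary pair
of colours gives two C_m-factors or two C_n-factors, as one likes. This only produces pairs,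
whereas alpha + beta = 2 w - 1 is odd.

(2) The colours -1 and 1 form a Hamilton cycle D, the colour 0 joins the positions of D like
the rungs of a ladder. The parallel edges over D and the vertical edges form a prism over D,
which splits into a C_{2r}-factor and a 1-factor for every even r dividing 2 w: cut the prism
into ladders of r rungs, close each of them with its two end rungs, and put what is left into
the 1-factor. This is the one factor whose type is chosen on its own.

(3) What remains is 4-regular: the crossed edges over D and all four edges over each rung. It
splits into two C_{4 kappa}-factors B and C whenever kappa divides w and kappa > 2. Each of
them runs up and down the ladder in two strands, and at a rung at which both strands change
copies one of the two factors can turn around while the other passes. So B turns at one residue
class of rungs modulo kappa and C at another ([core_ladder]). For even w all this takes an
exchange of the two copies along one edge of D ([twist]). For kappa = 1 the squares over the
rungs serve, together with squares made of vertical and crossed edges over D; the 1-factor then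
consists of the other crossed edges ([core_four]).

Taking kappa = k or kappa = k t, together with the free type in (2), gives every pair (alpha,
beta) ([HWP_core]) except when the one possible choice is kappa = 2. Then all factors but one
are octagons, and another construction, based on blowing up K_w by 4, gives these
([decomposable_octagons], and [core_two] for v = 8).

Every cycle factor is described by giving each vertex the number of its cycle and its place on
it. Since the factors of such a family have together exactly as many edges as K_v, they are
disjoint as soon as they cover K_v ([HWP_of_labellings]); so for each edge it suffices to name
one factor, and the case analysis that does this is linear arithmetic. *)

Set Implicit Arguments.
Unset Strict Implicit.
Unset Printing Implicit Defensive.

(** * Cycle factors given by labellings *)

(** Neighbouring places on a cycle of length n, whose places are 0, ..., n - 1. *)
Definition near (n i j : nat) : bool :=
  [|| j == i.+1, i == j.+1, (i == 0) && (j.+1 == n) | (j == 0) && (i.+1 == n)].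

(** The label of a vertex is the number of its cycle and its place on that cycle. *)
Definition linked (n : nat) (p q : nat * nat) : bool :=
  (p.1 == q.1) && near n p.2 q.2.

(** Injectivity and the two bounds make the labelling a bijection onto all pairs of a cycle number
and a place, so that every cycle is complete. *)
Definition cycle_labelling (T : finType) (n : nat) (lab : T -> nat * nat) : Prop :=
  [/\ injective lab, forall x, (lab x).1 < #|T| %/ n & forall x, (lab x).2 < n].

Section LabelledFactor.
Variables (T : finType) (n : nat) (lab : T -> nat * nat).
Hypotheses (n_gt2 : 2 < n) (n_dvd : n %| #|T|) (labP : cycle_labelling n lab).

Let lab_inj : injective lab. Proof. by case: labP. Qed.

(** There are as many admissible labels as vertices. *)
Lemma labelling_surj b i : b < #|T| %/ n -> i < n -> exists x, lab x = (b, i).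
Proof.
case: labP => _ lab1 lab2 ltb lti.
pose g x : 'I_(#|T| %/ n) * 'I_n := (Ordinal (lab1 x), Ordinal (lab2 x)).
have g_inj : injective g.
  move=> x y [e1 e2]; apply: lab_inj.
  by rewrite [lab x]surjective_pairing [lab y]surjective_pairing e1 e2.
have [|h _ gK] := inj_card_bij g_inj.
  by rewrite card_prod !card_ord divnK.
exists (h (Ordinal ltb, Ordinal lti)).
have := gK (Ordinal ltb, Ordinal lti).
by rewrite {1}/g => -[e1 e2]; rewrite [lab _]surjective_pairing e1 e2.
Qed.

Definition cyc_succ i := if i.+1 == n then 0 else i.+1.

Lemma cyc_succP i :
  i.+1 = n /\ cyc_succ i = 0 \/ i.+1 <> n /\ cyc_succ i = i.+1.
Proof. by rewrite /cyc_succ; case: eqP; [left|right]. Qed.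

Definition label_next x : T :=
  odflt x [pick y | lab y == ((lab x).1, cyc_succ (lab x).2)].

Lemma label_nextE x : lab (label_next x) = ((lab x).1, cyc_succ (lab x).2).
Proof.
rewrite /label_next; case: pickP => [y /eqP //|no].
case: labP => _ /(_ x) lt1 /(_ x) lt2.
have lt2' : cyc_succ (lab x).2 < n by rewrite /cyc_succ; case: eqP; lia.
by have [y /eqP] := labelling_surj lt1 lt2'; rewrite no.
Qed.

Let f := label_next.

Lemma label_next_inj : injective f.
Proof.
move=> x y /(congr1 lab); rewrite !label_nextE => -[e1 e2]; apply: lab_inj.
rewrite [lab x]surjective_pairing [lab y]surjective_pairing e1; congr pair.
move: e2; rewrite /cyc_succ; case: labP => _ _ b.
by have := b x; have := b y; do 2! case: eqP; lia.
Qed.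

(** Iterating [label_next] adds to the place modulo n; this is what gives orbits of size n. *)
Lemma label_iter j x :
  lab (iter j f x) =
    ((lab x).1, ((lab x).2 + j) %% n).
Proof.
have b y : (lab y).2 < n by case: labP.
elim: j => [|j IH] /=; first by rewrite addn0 modn_small // -surjective_pairing.
rewrite label_nextE IH /=; congr pair; rewrite /cyc_succ addnS -addn1 -[in RHS]addn1.
have n0 : 0 < n by lia.
rewrite -[in RHS]modnDml addn1; case: eqP => [->|ne]; first by rewrite modnn.
by rewrite [RHS]modn_small //; have := ltn_pmod ((lab x).2 + j) n0; lia.
Qed.

Lemma label_order x : fingraph.order f x = n.
Proof.
have b z : (lab z).2 < n by case: labP.
have n0 : 0 < n by lia.
have itn y : iter n f y = y.
  by apply: lab_inj; rewrite label_iter modnDr modn_small // -surjective_pairing.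
apply/eqP; rewrite eqn_leq; apply/andP; split.
  rewrite leqNgt; apply/negP => /findex_iter.
  by rewrite itn findex0; lia.
rewrite leqNgt; apply/negP => lt.
have := congr1 lab (iter_order label_next_inj x).
rewrite label_iter => /(congr1 snd) /=.
set o := fingraph.order f x in lt *.
have o0 : 0 < o by exact: fingraph.order_gt0.
have [l|g] := ltnP ((lab x).2 + o) n; first by rewrite modn_small //; lia.
rewrite -[in LHS](subnK g) modnDr modn_small; last by have := b x; lia.
by have := b x; lia.
Qed.

Lemma label_next_neq x : f x != x.
Proof.
have b z : (lab z).2 < n by case: labP.
apply/eqP => /(congr1 lab); rewrite label_nextE => /(congr1 snd) /=.
by have := b x; have := cyc_succP (lab x).2; lia.
Qed.

Lemma label_next2_neq x : f (f x) != x.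
Proof.
have b z : (lab z).2 < n by case: labP.
apply/eqP => /(congr1 lab); rewrite !label_nextE /= => /(congr1 snd) /=.
have := b x; have := cyc_succP (lab x).2; have := cyc_succP (cyc_succ (lab x).2).
lia.
Qed.

Definition label_edges : {set {set T}} := [set [set x; f x] | x : T].

Lemma set2_inj (x y z : T) : [set x; y] = [set x; z] -> y = z.
Proof.
move=> e; have := set22 x y; rewrite e => /set2P [yx|//].
by have := set22 x z; rewrite -e yx => /set2P [->|->].
Qed.

Lemma mem_label_edges x y :
  ([set x; y] \in label_edges) = (y == f x) || (x == f y).
Proof.
apply/imsetP/orP => [[z _ e]|[/eqP ->|/eqP ->]]; last 2 first.
- by exists x.
- by exists y => //; rewrite setUC.
have /set2P [zx|zx] : x \in [set z; f z] by rewrite -e set21.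
  by left; move: e; rewrite -zx => /set2_inj ->.
right; move: e; rewrite -zx [RHS]setUC => /set2_inj ->; exact/eqP.
Qed.

Lemma linked_label_edges x y :
  linked n (lab x) (lab y) -> [set x; y] \in label_edges.
Proof.
have b z : (lab z).2 < n by case: labP.
rewrite mem_label_edges => /andP [/eqP e1 nr].
have suc z t : (lab z).1 = (lab t).1 -> (lab t).2 = cyc_succ (lab z).2 -> t = f z.
  move=> e e'; apply: lab_inj.
  by rewrite label_nextE [lab t]surjective_pairing e e'.
have : (lab y).2 = cyc_succ (lab x).2 \/ (lab x).2 = cyc_succ (lab y).2.
  move: nr; rewrite /near; have := b x; have := b y.
  by have := cyc_succP (lab x).2; have := cyc_succP (lab y).2; lia.
by case=> e; apply/orP; [left|right]; apply/eqP; apply: suc.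
Qed.

Lemma label_edges_sub : label_edges \subset complete_graph T.
Proof.
apply/subsetP => _ /imsetP [x _ ->].
by rewrite inE cards2 (eq_sym x) label_next_neq.
Qed.

Lemma label_edges_degree x : degree label_edges x = 2.
Proof.
rewrite /degree.
have [h hK fK] : bijective f by apply: injF_bij; exact: label_next_inj.
have -> : [set e in label_edges | x \in e] = [set [set x; f x]; [set h x; x]].
  apply/setP => e; rewrite !inE; apply/andP/orP.
    case=> /imsetP [z _ ->] /set2P [->|->]; first by left.
    by right; rewrite hK.
  case=> /eqP ->; rewrite ?set21 ?set22 mem_label_edges ?eqxx ?orbT //.
  by rewrite fK eqxx.
rewrite cards2; apply/eqP; rewrite eqSS eqb1; apply/eqP.
rewrite (setUC [set h x]) => /set2_inj e.
by have := label_next2_neq x; rewrite e fK eqxx.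
Qed.

Lemma adjacent_label x y :
  adjacent label_edges x y = (y == f x) || (x == f y).
Proof. by rewrite /adjacent mem_label_edges. Qed.

Lemma label_connect x y :
  connect (adjacent label_edges) x y = fconnect f x y.
Proof.
apply/idP/idP.
  apply: connect_sub => z t; rewrite adjacent_label => /orP [/eqP ->|/eqP ->].
    exact: fconnect1.
  by rewrite fconnect_sym; [exact: fconnect1 | exact: label_next_inj].
apply: connect_sub => z t /eqP <-.
by apply: connect1; rewrite adjacent_label eqxx.
Qed.

(** The component of a vertex is its orbit under [label_next], read as a cycle. *)
Lemma label_component x : cycle_graph n (component label_edges x).
Proof.
exists (orbit f x); split=> //.
  by rewrite size_orbit label_order.
have nx z : z \in orbit f x -> next (orbit f x) z = f z.
  move=> zin; apply/eqP; rewrite eq_sym.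
  exact: (next_cycle (cycle_orbit label_next_inj x)).
apply/setP => e; rewrite !inE; apply/andP/imsetP.
  case=> /imsetP [z _ ->] /subsetP /(_ z (set21 _ _)).
  rewrite inE label_connect fconnect_orbit => zin.
  by exists z => //; rewrite nx.
case=> z zin ->; rewrite nx // mem_label_edges eqxx; split=> //.
apply/subsetP => t /set2P [->|->]; rewrite inE label_connect.
  by rewrite fconnect_orbit.
by apply: connect_trans (fconnect1 _ _); rewrite fconnect_orbit.
Qed.

Lemma card_label_edges : #|label_edges| <= #|T|.
Proof. exact: leq_imset_card. Qed.

End LabelledFactor.

(** * Covering families of factors, and the degree count *)

Section Matching.
Variables (T : finType) (mate : T -> T).
Hypotheses (mateK : involutive mate) (mate_neq : forall x, mate x != x).

Definition mate_edges : {set {set T}} := [set [set x; mate x] | x : T].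

Lemma mem_mate_edges x y : ([set x; y] \in mate_edges) = (y == mate x).
Proof.
apply/imsetP/eqP => [[z _ e]|->]; last by exists x.
have /set2P [zx|zx] : x \in [set z; mate z] by rewrite -e set21.
  by move: e; rewrite -zx => /set2_inj.
by move: e; rewrite zx mateK -zx [RHS]setUC zx => /set2_inj.
Qed.

Lemma mate_one_factor : one_factor (complete_graph T) mate_edges.
Proof.
split=> [|x].
  by apply/subsetP => _ /imsetP [x _ ->]; rewrite inE cards2 (eq_sym x) mate_neq.
rewrite /degree -(cards1 [set x; mate x]); congr #|pred_of_set _|.
apply/setP => e; rewrite !inE; apply/andP/eqP => [[]|->].
  by case/imsetP => z _ -> /set2P [->|->] //; rewrite mateK setUC.
by rewrite mem_mate_edges eqxx set21.
Qed.

Lemma card_mate_edges : #|mate_edges|.*2 <= #|T|.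
Proof.
pose g x := [set x; mate x].
rewrite -[#|T|]sum1_card (partition_big g (mem mate_edges)) => [|x _]; last first.
  exact: imset_f.
rewrite -muln2 -sum_nat_const; apply: leq_sum => _ /imsetP [x _ ->].
have sub : [set x; mate x] \subset [pred y | g y == [set x; mate x]].
  apply/subsetP => y /set2P [->|->]; rewrite inE /g ?mateK //.
  by rewrite setUC.
by rewrite sum1_card (leq_trans _ (subset_leq_card sub)) // cards2 (eq_sym x) mate_neq.
Qed.

End Matching.

Section Criterion.
Variables (T J : finType) (ty : J -> bool) (m n : nat).
Variables (lab : J -> T -> nat * nat) (mate : T -> T).

Let len j := if ty j then m else n.

Hypotheses (m_gt2 : 2 < m) (n_gt2 : 2 < n) (m_dvd : m %| #|T|) (n_dvd : n %| #|T|).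
Hypothesis card_J : #|J|.*2 + 2 = #|T|.
Hypothesis labP : forall j, cycle_labelling (len j) (lab j).
Hypotheses (mateK : involutive mate) (mate_neq : forall x, mate x != x).
Hypothesis covered : forall x y, x != y ->
  (y == mate x) || [exists j, linked (len j) (lab j x) (lab j y)].

Let F j := label_edges (len j) (lab j).
Let I := mate_edges mate.
Let K := complete_graph T.

Let len_gt2 j : 2 < len j. Proof. by rewrite /len; case: ifP. Qed.
Let len_dvd j : len j %| #|T|. Proof. by rewrite /len; case: ifP. Qed.

(** The factors and the 1-factor have together at most as many edges as the complete graph, since
#|T| = 2 #|J| + 2; as they cover it, no edge can be covered twice. *)
Lemma cover_once e : e \in K -> (e \in I) + \sum_j (e \in F j) = 1.
Proof.
pose cnt e := (e \in I) + \sum_j (e \in F j).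
have ge1 f : f \in K -> 0 < cnt f.
  rewrite inE => /cards2P [x [y [xy ->]]]; rewrite /cnt.
  have /orP [yx|/existsP [j lk]] := covered xy; first by rewrite mem_mate_edges // yx.
  rewrite (bigD1 j) //= addnCA (linked_label_edges _ _ (labP j) lk) //.
have le : \sum_(f in K) cnt f <= #|K|.
  have part (S : {set {set T}}) : \sum_(f in K) (f \in S) <= #|S|.
    rewrite -sum1_card big_mkcond [leqRHS]big_mkcond leq_sum // => f _ /=.
    by case: (f \in K); case: (f \in S).
  rewrite big_split exchange_big /= /K /complete_graph card_draws bin2.
  have lI : \sum_(f in K) (f \in I) <= #|J|.+1.
    apply: leq_trans (part I) _.
    by have := card_mate_edges mateK mate_neq; rewrite -/I; lia.
  have lF : \sum_j \sum_(f in K) (f \in F j) <= #|J| * #|T|.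
    rewrite -sum_nat_const; apply: leq_sum => j _.
    exact: leq_trans (part _) (card_label_edges _ _).
  apply: leq_trans (leq_add lI lF) _.
  by rewrite -card_J; lia.
move=> eK; apply/eqP; rewrite eqn_leq ge1 // andbT leqNgt; apply/negP => gt1.
move: le; rewrite -sum1_card leqNgt => /negP; apply.
(* One edge covered twice makes the total count exceed the number of edges. *)
rewrite (bigD1 e) // [X in _ < X](bigD1 e) //= -addSn; apply: leq_add => //.
by apply: leq_sum => f /andP [fK _]; exact: ge1.
Qed.

Lemma labelled_edge_notin_mate j e : e \in F j -> e \notin I.
Proof.
move=> ej; have eK := subsetP (label_edges_sub (len_gt2 j) (len_dvd j) (labP j)) _ ej.
have := cover_once eK; rewrite (bigD1 j) //= ej.
by case: (e \in I).
Qed.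

Lemma labelled_edge_uniq i j e : e \in F i -> e \in F j -> i = j.
Proof.
move=> ei ej; have eK := subsetP (label_edges_sub (len_gt2 j) (len_dvd j) (labP j)) _ ej.
have := cover_once eK; case: (eqVneq i j) => // ne.
by rewrite (bigD1 j) //= ej (bigD1 i) //= ei; lia.
Qed.

Lemma labelled_factor j : C_factor (len j) (K :\: I) (F j).
Proof.
split; last exact: label_component.
split; last exact: label_edges_degree.
apply/subsetP => e ej; rewrite in_setD (labelled_edge_notin_mate ej).
exact: (subsetP (label_edges_sub (len_gt2 j) (len_dvd j) (labP j))).
Qed.

(** Covering is the whole verification: edge-disjointness comes from [cover_once], and distinct
indices give distinct factors because factors are not empty. *)
Lemma labelled_factorization :
  one_factor K I /\
  has_two_factorization (K :\: I) m n #|[set j | ty j]| #|[set j | ~~ ty j]|.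
Proof.
split; first exact: mate_one_factor.
have [x0 _] : exists x : T, x \in T by apply/card_gt0P; rewrite -card_J addn2.
have F_edge j : [set x0; label_next (len j) (lab j) x0] \in F j by exact: imset_f.
have F_inj : injective F.
  by move=> i j e; apply: (@labelled_edge_uniq i j _ (F_edge i)); rewrite -e.
exists (F @: [set j | ty j]), (F @: [set j | ~~ ty j]); split.
- rewrite -setI_eq0; apply/eqP; apply/setP => S; rewrite !inE.
  apply/negP => /andP [/imsetP [i]]; rewrite inE => ti -> /imsetP [j].
  by rewrite inE => tj /F_inj e; rewrite -e ti in tj.
- have -> : F @: [set j | ty j] :|: F @: [set j | ~~ ty j] = F @: setT.
    rewrite -imsetU (_ : [set j | ty j] :|: _ = setT) //.
    by apply/setP => j; rewrite !inE orbN.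
  apply/and3P; split.
  + apply/eqP; rewrite /cover; apply/setP => e; apply/bigcupP/idP.
      case=> _ /imsetP [j _ ->] ej; rewrite in_setD (labelled_edge_notin_mate ej).
      exact: (subsetP (label_edges_sub (len_gt2 j) (len_dvd j) (labP j))).
    rewrite in_setD => /andP [eI eK].
    have := cover_once eK; rewrite (negPf eI) add0n => s1.
    have [j ej] : exists j, e \in F j.
      apply/existsP; rewrite -[[exists _, _]]negbK negb_exists; apply/negP => /forallP no.
      by move: s1; rewrite big1 // => j _; rewrite (negPf (no j)).
    by exists (F j) => //; apply: imset_f.
  + apply/trivIsetP => _ _ /imsetP [i _ ->] /imsetP [j _ ->] ne.
    rewrite -setI_eq0; apply/eqP; apply/setP => e; rewrite !inE; apply/negP => /andP [ei ej].
    by rewrite (labelled_edge_uniq ei ej) eqxx in ne.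
  + by apply/imsetP => -[j _ e]; have := F_edge j; rewrite -e inE.
- by rewrite !card_imset.
- by move=> S /imsetP [j]; rewrite inE => tj ->; have := labelled_factor j; rewrite /len tj.
- move=> S /imsetP [j]; rewrite inE => tj ->; have := labelled_factor j.
  by rewrite /len (negPf tj).
Qed.

End Criterion.

(** The same over an arbitrary vertex type, which may be the type best suited to a construction. *)
Theorem HWP_of_labellings (T J : finType) (ty : J -> bool) (m n : nat)
    (lab : J -> T -> nat * nat) (mate : T -> T) :
  2 < m -> 2 < n -> m %| #|T| -> n %| #|T| -> #|J|.*2 + 2 = #|T| ->
  (forall j, cycle_labelling (if ty j then m else n) (lab j)) ->
  involutive mate -> (forall x, mate x != x) ->
  (forall x y, x != y -> (y == mate x) ||
     [exists j, linked (if ty j then m else n) (lab j x) (lab j y)]) ->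
  HWP #|T| m n (#|[set j | ty j]|, #|[set j | ~~ ty j]|).
Proof.
move=> m2 n2 md nd cJ labP mateK mate_neq cov.
pose lab' j (i : 'I_#|T|) := lab j (enum_val i).
pose mate' (i : 'I_#|T|) := enum_rank (mate (enum_val i)).
have val_inj : injective (@enum_val T T) by exact: enum_val_inj.
have labP' j : cycle_labelling (if ty j then m else n) (lab' j).
  have [l1 l2 l3] := labP j; split=> [x y /l1 /val_inj //|x|x]; rewrite ?card_ord.
    exact: l2.
  exact: l3.
exists (mate_edges mate'); apply: (@labelled_factorization _ J ty m n lab' mate').
all: rewrite ?card_ord //.
- by move=> x; rewrite /mate' enum_rankK mateK enum_valK.
- move=> x; apply: contra (mate_neq (enum_val x)) => /eqP e.
  by rewrite -{2}e /mate' enum_rankK.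
- move=> x y ne; have ne' : enum_val x != enum_val y by apply: contra ne => /eqP/val_inj ->.
  have /orP [/eqP e|ex] := cov _ _ ne'; apply/orP; [left|by right].
  by rewrite /mate' -e enum_valK.
Qed.

(** Compare degrees at one vertex: v - 1 = 1 + 2 (alpha + beta). *)
Lemma HWP_count v m n alpha beta :
  2 <= v -> HWP v m n (alpha, beta) -> alpha + beta = (v - 2) %/ 2.
Proof.
move=> v2 [I [[subI degI] [A [B [disjAB partAB [cardA cardB] FA FB]]]]].
have x0 : 'I_v by exact: (Ordinal (ltnW v2)).
pose K := complete_graph 'I_v.
have degE (S : {set {set 'I_v}}) : degree S x0 = \sum_(e in S) (x0 \in e).
  by rewrite /degree -sum1_card big_mkcond [RHS]big_mkcond; apply: eq_bigr => e _;
     rewrite inE; case: (e \in S); case: (x0 \in e).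
have degK : degree K x0 = v.-1.
  have -> : v.-1 = #|[set~ x0]| by rewrite cardsC1 card_ord.
  rewrite -(card_in_imset (f := fun y => [set x0; y])) => [|y z _ _]; last first.
    exact: set2_inj.
  congr #|pred_of_set _|; apply/setP => e; rewrite !inE; apply/andP/imsetP.
    case=> /cards2P [y [z [yz ->]]] /set2P [] e0.
      by exists z; rewrite ?inE ?e0 // eq_sym.
    by exists y; rewrite ?inE ?e0 // setUC.
  case=> y; rewrite !inE => ne ->; rewrite set21; split=> //.
  by rewrite cards2 (eq_sym x0) ne.
have degP : degree (K :\: I) x0 = (#|A| + #|B|).*2.
  have [/eqP <- triv _] := and3P partAB.
  rewrite degE big_trivIset //= (eq_bigr (fun=> 2)).
    rewrite sum_nat_const cardsU (_ : A :&: B = set0) ?cards0 ?subn0 ?muln2 //.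
    by apply/eqP; rewrite setI_eq0.
  move=> F; rewrite -degE inE => /orP [/FA|/FB] [[_ deg] _]; exact: deg.
have : degree K x0 = degree I x0 + degree (K :\: I) x0.
  rewrite !degE (big_setID I) /=; congr (_ + _); apply: eq_bigl => e.
  by rewrite inE andbC; case: (boolP (e \in I)) => // /(subsetP subI) ->.
by rewrite degK degI degP cardA cardB /=; lia.
Qed.

(** * Hamilton cycles in the round-robin tournament *)

(** The players of the tournament are the residues modulo 2 w - 1 and a point at infinity, coded as
2 w - 1. The colours -1 and 1 (the pairs of sum -1 or 1) form the Hamilton cycle 0, 1, -2, 3,
-4, ..., on which the point at infinity comes at place w; [elt w i] is its i-th player. On it
the colour 0 (the pairs of opposite residues) joins the places i and 2 w - i, and 0 and w. *)
Definition elt w i :=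
  if i == w then w.*2.-1 else if i == 0 then 0 else
  if i < w then (if odd i then i else w.*2.-1 - i)
  else (if odd i then i.-1 else w.*2 - i).

(** The place of the player y on the Hamilton cycle formed by the colours 2 s and 2 s + 1, which
starts at infinity and then visits s, s + 1, s - 1, s + 2, s - 2, ... *)
Definition zigzag w s y :=
  let z := if s <= y then y - s else y + w.*2.-1 - s in
  if y == w.*2.-1 then 0 else if z == 0 then 1 else
  if z < w then z.*2 else 4 * w - 1 - z.*2.

(** The pairs of players of sum c modulo 2 w - 1, the point at infinity being matched with the
player whose double is c: one round of the tournament. *)
Definition colour w c y y' :=
  if y == w.*2.-1 then (y'.*2 == c) || (y'.*2 == c + w.*2.-1)
  else if y' == w.*2.-1 then (y.*2 == c) || (y.*2 == c + w.*2.-1)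
  else (y + y' == c) || (y + y' == c + w.*2.-1).

Lemma colour_ex w y y' : 1 < w -> y < w.*2 -> y' < w.*2 -> y != y' ->
  exists2 c, c < w.*2.-1 & colour w c y y'.
Proof.
move=> w2 y2 y'2 ne.
have red T : T < w.*2.-1 + w.*2.-1 ->
    exists2 c, c < w.*2.-1 & (T == c) || (T == c + w.*2.-1).
  move=> lt; have [lt'|ge] := ltnP T w.*2.-1; first by exists T; rewrite ?eqxx.
  by exists (T - w.*2.-1); rewrite ?subnK ?eqxx ?orbT ?ltn_subLR.
rewrite /colour; have [yN|yN] := eqVneq y w.*2.-1; first by apply: red; lia.
by have [y'N|y'N] := eqVneq y' w.*2.-1; apply: red; lia.
Qed.

Variant zigzag_spec w s y : nat -> Prop :=
| Zinf of y = w.*2.-1 : zigzag_spec w s y 0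
| Zup z of 0 < z < w & (y == s + z) || (y + w.*2.-1 == s + z) & y < w.*2.-1 :
    zigzag_spec w s y z.*2
| Zdown z of z < w & (y + z == s) || (y + z == s + w.*2.-1) & y < w.*2.-1 :
    zigzag_spec w s y z.*2.+1.

Lemma zigzagP w s y : 1 < w -> s < w -> y < w.*2 -> zigzag_spec w s y (zigzag w s y).
Proof.
move=> w2 sw y2; rewrite /zigzag /=; case: eqP => [?|yN]; first by constructor.
set z := if s <= y then _ else _.
have zE : (z == y - s) && (s <= y) || (z == y + w.*2.-1 - s) && (y < s).
  by rewrite /z; case: ifP; lia.
move: z zE => z zE; case: eqP => [z0|z0].
  by apply: (@Zdown _ _ _ 0); lia.
case: ifP => zw; first by apply: Zup; lia.
have -> : 4 * w - 1 - z.*2 = (w.*2.-1 - z).*2.+1 by lia.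
by apply: Zdown; lia.
Qed.

Lemma zigzag_lt w s y : 1 < w -> s < w -> y < w.*2 -> zigzag w s y < w.*2.
Proof. by move=> w1 sw yw; case: (zigzagP w1 sw yw) => *; lia. Qed.

Lemma zigzag_inj w s y y' : 1 < w -> s < w -> y < w.*2 -> y' < w.*2 ->
  zigzag w s y = zigzag w s y' -> y = y'.
Proof.
move=> w2 sw y2 y'2.
case: (zigzagP w2 sw y2) => [->|z zw ez yN|z zw ez yN];
case: (zigzagP w2 sw y'2) => [->|t tw et tN|t tw et tN] // e; try (by exfalso; lia).
  have {}e : z = t by [lia]; rewrite {}e in ez *; lia.
have {}e : z = t by [lia]; rewrite {}e in ez *; lia.
Qed.

Definition next_in n i j := (j == i.+1) || (i.+1 == n) && (j == 0).

(** The parity tells the two colours of the Hamilton cycle apart: the colour 2 s leaves the even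
places upwards, and the colour 2 s + 1 the odd ones. *)
Lemma zigzag_next w s b y y' : 1 < w -> s < w -> y < w.*2 -> y' < w.*2 -> y != y' ->
  s.*2 + nat_of_bool b < w.*2.-1 -> colour w (s.*2 + nat_of_bool b) y y' ->
  next_in w.*2 (zigzag w s y) (zigzag w s y') && (odd (zigzag w s y) == b) ||
  next_in w.*2 (zigzag w s y') (zigzag w s y) && (odd (zigzag w s y') == b).
Proof.
move=> w2 sw; have fin z : z < w.*2.-1 -> (z == w.*2.-1) = false by move=> /ltn_eqF.
have inf_down z : 0 < w -> (b = false /\ z = 0) \/ (b = true /\ z.+1 = w) ->
    next_in w.*2 0 z.*2.+1 && (odd 0 == b) || next_in w.*2 z.*2.+1 0 && (odd z.*2.+1 == b).
  move=> w0 [[-> ->] //|[-> zE]]; rewrite /next_in -zE doubleS eqxx /= odd_double.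
  by rewrite orbT.
have up_down z : next_in w.*2 (z + nat_of_bool b).*2 z.*2.+1 && (odd (z + nat_of_bool b).*2 == b) ||
    next_in w.*2 z.*2.+1 (z + nat_of_bool b).*2 && (odd z.*2.+1 == b).
  case: (b) => /=; rewrite /next_in ?addn1 ?addn0 ?doubleS /= ?odd_double /= eqxx //.
  by rewrite orbC.
move=> y2 y'2 ne cN; rewrite /colour.
case: (zigzagP w2 sw y2) => [yE|z zw ez yN|z zw ez yN];
case: (zigzagP w2 sw y'2) => [y'E|t tw et tN|t tw et tN].
- by rewrite yE y'E eqxx in ne.
- by rewrite yE eqxx => col; exfalso; case: (b) cN col => /=; lia.
- by rewrite yE eqxx => col; apply: inf_down; [lia | case: (b) cN col => /=; lia].
- by rewrite y'E eqxx (fin _ yN) => col; exfalso; case: (b) cN col => /=; lia.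
- by rewrite !fin // => col; exfalso; case: (b) cN col => /=; lia.
- rewrite !fin // => col; have -> : z = t + nat_of_bool b by case: (b) cN col => /=; lia.
  exact: up_down.
- rewrite y'E eqxx (fin _ yN) => col; rewrite orbC.
  by apply: inf_down; [lia | case: (b) cN col => /=; lia].
- rewrite !fin // => col; rewrite orbC; have -> : t = z + nat_of_bool b by case: (b) cN col => /=; lia.
  exact: up_down.
by rewrite !fin // => col; exfalso; case: (b) cN col => /=; lia.
Qed.

Variant elt_spec w i : nat -> Prop :=
| Einf of i = w : elt_spec w i w.*2.-1
| Eid of (i == 0) || odd i & i < w : elt_spec w i i
| Eopp of 0 < i < w & ~~ odd i : elt_spec w i (w.*2.-1 - i)
| Eodd of w < i & odd i : elt_spec w i i.-1
| Eeven of w < i & ~~ odd i : elt_spec w i (w.*2 - i).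

Lemma eltP w i : elt_spec w i (elt w i).
Proof.
rewrite /elt; case: eqP => [->|iw]; first by constructor.
case: eqP => [i0|i0]; first by rewrite i0; apply: Eid; lia.
case: ltnP => iw'; case: ifP => oi.
- by apply: Eid; lia.
- by apply: Eopp; lia.
- by apply: Eodd; lia.
- by apply: Eeven; lia.
Qed.

Lemma elt_lt w i : 1 < w -> i < w.*2 -> elt w i < w.*2.
Proof. by move=> w1 iw; case: (eltP w i) => *; lia. Qed.

Lemma elt_inj w i i' : 1 < w -> i < w.*2 -> i' < w.*2 -> elt w i = elt w i' -> i = i'.
Proof.
move=> w1 iw i'w; case: (eltP w i) => [->|oi li|li oi|li oi|li oi];
case: (eltP w i') => [->|oi' li'|li' oi'|li' oi'|li' oi'] // e; try (by exfalso; lia); lia.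
Qed.

(** The exceptional colours on the finite players, that is, away from the position w. *)
Lemma special_finite w c i i' : 1 < w -> i < w.*2 -> i' < w.*2 -> i != i' ->
  i != w -> i' != w -> [|| c == 0, c == 1 | c == w.*2 - 2] ->
  (elt w i + elt w i' == c) || (elt w i + elt w i' == c + w.*2.-1) ->
  [\/ i + i' = w.*2, next_in w.*2 i i' | next_in w.*2 i' i].
Proof.
move=> w1 iw i'w ne iw' i'w' cc col.
have up : i' = i.+1 -> next_in w.*2 i i' by move=> ->; rewrite /next_in eqxx.
have down : i = i'.+1 -> next_in w.*2 i' i by move=> ->; rewrite /next_in eqxx.
case: (eltP w i) col => [e|oi li|li oi|li oi|li oi]; try (by rewrite e eqxx in iw');
case: (eltP w i') => [e'|oi' li'|li' oi'|li' oi'|li' oi'] col; try (by rewrite e' eqxx in i'w').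
- have [e|e] : i' = i.+1 \/ i = i'.+1 by lia.
    by constructor 2; apply: up.
  by constructor 3; apply: down.
- have [e|e] : i' = i.+1 \/ i = i'.+1 by lia.
    by constructor 2; apply: up.
  by constructor 3; apply: down.
- have [e|[e e']] : i + i' = w.*2 \/ i = 0 /\ i'.+1 = w.*2 by lia.
    by constructor 1.
  by constructor 3; rewrite /next_in e e' eqxx orbT.
- by constructor 1; lia.
- have [e|e] : i' = i.+1 \/ i = i'.+1 by lia.
    by constructor 2; apply: up.
  by constructor 3; apply: down.
- by exfalso; lia.
- by constructor 1; lia.
- by constructor 1; lia.
- have [e|[e e']] : i + i' = w.*2 \/ i' = 0 /\ i.+1 = w.*2 by lia.
    by constructor 1.
  by constructor 2; rewrite /next_in e e' eqxx orbT.
- by constructor 1; lia.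
- by exfalso; lia.
- have [e|e] : i' = i.+1 \/ i = i'.+1 by lia.
    by constructor 2; apply: up.
  by constructor 3; apply: down.
- by constructor 1; lia.
- by constructor 1; lia.
- have [e|e] : i' = i.+1 \/ i = i'.+1 by lia.
    by constructor 2; apply: up.
  by constructor 3; apply: down.
by exfalso; lia.
Qed.

(** The partners of the point at infinity in the exceptional colours. *)
Lemma special_infty w c i : 1 < w -> i < w.*2 -> i != w ->
  [|| c == 0, c == 1 | c == w.*2 - 2] ->
  ((elt w i).*2 == c) || ((elt w i).*2 == c + w.*2.-1) ->
  [\/ i = 0, w = i.+1 | i = w.+1].
Proof.
move=> w1 iw ne cc; case: (eltP w i) => [e|oi li|li oi|li oi|li oi] col.
- by rewrite e eqxx in ne.
- have [e|e] : i = 0 \/ w = i.+1 by lia.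
    by constructor 1.
  by constructor 2.
- by constructor 2; lia.
- by constructor 3; lia.
by constructor 3; lia.
Qed.

Lemma elt_infty w i : 1 < w -> i < w.*2 -> (elt w i == w.*2.-1) = (i == w).
Proof.
move=> w1 iw; case: (eltP w i) => [->|oi li|li oi|li oi|li oi]; first by rewrite !eqxx.
all: by have -> : (i == w) = false; [lia | apply/eqP; lia].
Qed.

(** The three exceptional colours, seen on the Hamilton cycle that two of them form. *)
Lemma special_pair w c i i' : 1 < w -> i < w.*2 -> i' < w.*2 -> i != i' ->
  [|| c == 0, c == 1 | c == w.*2 - 2] -> colour w c (elt w i) (elt w i') ->
  [|| near w.*2 i i', i + i' == w.*2 | (i + i' == w) && ((i == 0) || (i' == 0))].
Proof.
move=> w2 i2 i'2 ne cc; rewrite /colour !elt_infty // /near.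
have [iw|iw] := eqVneq i w; [|have [i'w|i'w] := eqVneq i' w] => col.
- have i'w : i' != w by rewrite -iw eq_sym.
  case: (special_infty w2 i'2 i'w cc col) => e.
  + by rewrite iw e addn0 !eqxx /= !orbT.
  + by rewrite iw -e eqxx /= orbT.
  by rewrite iw e eqxx.
- case: (special_infty w2 i2 iw cc col) => e.
  + by rewrite i'w e add0n !eqxx /= !orbT.
  + by rewrite i'w -e eqxx.
  by rewrite i'w e eqxx /= orbT.
have [->|nx|nx] := special_finite w2 i2 i'2 ne iw i'w cc col; first by rewrite eqxx orbT.
  by case/orP: nx => [/eqP ->|/andP [-> ->]]; rewrite ?eqxx ?orbT.
by case/orP: nx => [/eqP ->|/andP [-> ->]]; rewrite ?eqxx ?orbT.
Qed.

(** * Doubling a cycle, and the prism over a cycle *)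

(** A labelling of the 4 w vertices (i, e) by N cycles of length n. *)
Definition chart (w N n : nat) (lab : nat -> bool -> nat * nat) : Prop :=
  [/\ N * n = 4 * w,
      forall i e i' e', i < w.*2 -> i' < w.*2 -> lab i e = lab i' e' -> i = i' /\ e = e' &
      forall i e, i < w.*2 -> (lab i e).1 < N /\ (lab i e).2 < n].

Lemma linked_sym n p q : linked n p q = linked n q p.
Proof. by rewrite /linked eq_sym; congr andb; rewrite /near; lia. Qed.

Lemma near_next n i j : near n i j = next_in n i j || next_in n j i.
Proof. by rewrite /near /next_in; lia. Qed.

Definition pred_in S q := if q == 0 then S.-1 else q.-1.

(** One step along a cycle of S * r places which is cut into S blocks of r places, in terms of the
number q of the block and the place p in it. *)
Variant step r S q p : nat -> nat -> Prop :=
| Inside of p.+1 < r : step r S q p q p.+1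
| Cross of p.+1 = r & q.+1 < S : step r S q p q.+1 0
| Wrap of p.+1 = r & q.+1 = S : step r S q p 0 0.

Lemma next_step r S k k' : 0 < r -> k < S * r -> k' < S * r -> next_in (S * r) k k' ->
  step r S (k %/ r) (k %% r) (k' %/ r) (k' %% r).
Proof.
move=> r0 kS k'S nx; have pr := ltn_pmod k r0.
have qS : k %/ r < S by rewrite ltn_divLR.
have kE := divn_eq k r; move: (k %/ r) (k %% r) kE pr qS => q p kE pr qS.
case: (ltnP p.+1 r) => p1.
  have -> : k' = q * r + p.+1.
    by move: nx; rewrite /next_in; have : q.+1 * r <= S * r by [rewrite leq_mul2r qS orbT]; lia.
  by rewrite divnMDl // divn_small // addn0 modnMDl modn_small //; constructor.
have p1' : p.+1 = r by lia.
case: (ltnP q.+1 S) => q1.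
  have -> : k' = q.+1 * r.
    by move: nx; rewrite /next_in; have : q.+2 * r <= S * r by [rewrite leq_mul2r q1 orbT]; lia.
  by rewrite mulnK // modnMl; constructor.
have qS' : q.+1 = S by lia.
have -> : k' = 0 by move: nx; rewrite /next_in kE -qS' in k'S *; lia.
by rewrite div0n mod0n; constructor.
Qed.

Lemma mod_succ i r : 0 < r -> i.+1 %% r = if (i %% r).+1 == r then 0 else (i %% r).+1.
Proof.
move=> r_gt0; rewrite -addn1 -modnDml addn1; have := ltn_pmod i r_gt0.
by case: eqP => [->|ne] lt; rewrite ?modnn // modn_small; lia.
Qed.

Lemma mod_pred_multiple n r : 0 < r -> 0 < n -> r %| n -> (n.-1 %% r).+1 = r.
Proof.
move=> r0 n0 rn; have := mod_succ n.-1 r0; rewrite prednK // (eqP rn).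
by case: eqP.
Qed.

Lemma block_inj S B q B' q' : q < S -> q' < S -> B * S + q = B' * S + q' -> B = B' /\ q = q'.
Proof.
move=> qS q'S e; have S0 : 0 < S by lia.
have := congr1 (divn^~ S) e; have := congr1 (modn^~ S) e.
by rewrite !modnMDl !divnMDl // !modn_small // !divn_small // !addn0.
Qed.

Lemma pred_in_lt S q : q < S -> pred_in S q < S.
Proof. by rewrite /pred_in; case: ifP; lia. Qed.

Section BlowUp.
Variables (w r S NB : nat) (h : nat -> nat * nat).
Hypotheses (r_even : ~~ odd r) (r_gt1 : 1 < r) (S_gt0 : 0 < S).
Hypothesis size_h : NB * (S * r) = w.*2.
Hypothesis h_inj : forall i i', i < w.*2 -> i' < w.*2 -> h i = h i' -> i = i'.
Hypothesis h_lt : forall i, i < w.*2 -> (h i).1 < NB /\ (h i).2 < S * r.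

(** The cycle number q leaves (0, true) at the start of its block, runs along the copy false
through the block, turns at the copy false of the first place of the next block, and runs back
along the copy true. It visits r.*2 vertices. *)
Definition turn_label (q p : nat) (e : bool) : nat * nat :=
  if p == 0 then if e then (q, 0) else (pred_in S q, r)
  else (q, if e then r.*2 - p else p).

(** The second factor is the image of the first one under the flip of the copies at the even
places. As r is even, this flip exchanges parallel and crossed edges inside the blocks and
exchanges the two ways to turn at their ends, so the two factors use complementary edges. *)
Definition blow_label (b : bool) (i : nat) (e : bool) : nat * nat :=
  let k := (h i).2 in
  let qj := turn_label (k %/ r) (k %% r) (if b then ~~ (e (+) odd (k %% r)) else e) in
  ((h i).1 * S + qj.1, qj.2).

Lemma turn_label_lt q p e : q < S -> p < r ->
  (turn_label q p e).1 < S /\ (turn_label q p e).2 < r.*2.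
Proof.
by move=> qS pr; have := pred_in_lt qS; rewrite /turn_label; case: eqP; case: e => /=; lia.
Qed.

Lemma turn_label_inj q p e q' p' e' : q < S -> p < r -> q' < S -> p' < r ->
  turn_label q p e = turn_label q' p' e' -> [/\ q = q', p = p' & e = e'].
Proof.
move=> qS pr q'S p'r; rewrite /turn_label /pred_in.
case: (eqVneq p 0) => p0; case: (eqVneq p' 0) => p'0; case: e; case: e' => -[] /=.
all: try (by move=> *; split=> //; lia).
all: (do ! case: eqP) => *; try split=> //; try lia.
Qed.

Lemma blow_chart b : chart w (NB * S) r.*2 (blow_label b).
Proof.
have r0 : 0 < r by lia.
have dm i : i < w.*2 -> (h i).2 %/ r < S /\ (h i).2 %% r < r.
  by move=> /h_lt [_ lt]; rewrite ltn_divLR // ltn_pmod.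
split=> [|i e i' e' ib i'b|i e ib].
- by rewrite -muln2 !mulnA -(mulnA NB) size_h; lia.
- have [qS pr] := dm _ ib; have [q'S p'r] := dm _ i'b.
  rewrite /blow_label; set f := (if b then _ else e); set f' := (if b then _ else e').
  move=> [eB e2].
  have [lt1 _] := turn_label_lt f qS pr; have [lt1' _] := turn_label_lt f' q'S p'r.
  have [hB e1] := block_inj lt1 lt1' eB.
  have [] := @turn_label_inj ((h i).2 %/ r) ((h i).2 %% r) f _ _ f' qS pr q'S p'r.
    by rewrite [LHS]surjective_pairing [RHS]surjective_pairing e1 e2.
  move=> eq ep ef.
  have hh : h i = h i'.
    rewrite [LHS]surjective_pairing [RHS]surjective_pairing hB.
    by rewrite (divn_eq (h i).2 r) eq ep -divn_eq.
  split; first exact: h_inj.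
  by move: ef; rewrite /f /f' ep; case: (b) => // /negb_inj /addIb.
- have [qS pr] := dm _ ib; have [hN _] := h_lt ib.
  rewrite /blow_label; set f := (if b then _ else e).
  have [lt1 lt2] := turn_label_lt f qS pr; split=> //=.
  have : (h i).1.+1 * S <= NB * S by rewrite leq_mul2r hN orbT.
  by lia.
Qed.

Lemma turn_label_step q p q' p' e e' : q < S -> p < r -> step r S q p q' p' ->
  linked r.*2 (turn_label q p e) (turn_label q' p' e') ||
  linked r.*2 (turn_label q p (~~ (e (+) odd p))) (turn_label q' p' (~~ (e' (+) odd p'))).
Proof.
move=> qS pr; case=> [p1|p1 q1|p1 q1] /=; rewrite /turn_label /pred_in /linked /near /=.
- have [->|p0] := eqVneq p 0; rewrite ?p0 /=.
    by case: e; case: e'; rewrite /=; lia.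
  by case: e; case: e'; case: (odd p) => /=; lia.
- have op : odd p by [lia]; rewrite op; have -> : (p == 0) = false by lia.
  by case: e; case: e' => /=; lia.
have op : odd p by [lia]; rewrite op; have -> : (p == 0) = false by lia.
by case: e; case: e' => /=; lia.
Qed.

Lemma blow_next i i' e e' : i < w.*2 -> i' < w.*2 ->
  (h i).1 = (h i').1 -> next_in (S * r) (h i).2 (h i').2 ->
  exists b, linked r.*2 (blow_label b i e) (blow_label b i' e').
Proof.
move=> ib i'b hB nx; have r0 : 0 < r by lia.
have [_ lt] := h_lt ib; have [_ lt'] := h_lt i'b.
have st := next_step r0 lt lt' nx.
have qS : (h i).2 %/ r < S by rewrite ltn_divLR.
have lk b : linked r.*2 (blow_label b i e) (blow_label b i' e') =
   linked r.*2 (turn_label ((h i).2 %/ r) ((h i).2 %% r)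
                  (if b then ~~ (e (+) odd ((h i).2 %% r)) else e))
               (turn_label ((h i').2 %/ r) ((h i').2 %% r)
                  (if b then ~~ (e' (+) odd ((h i').2 %% r)) else e')).
  by rewrite /linked /blow_label hB eqn_add2l.
have /orP [l|l] := turn_label_step e e' qS (ltn_pmod _ r0) st.
  by exists false; rewrite lk.
by exists true; rewrite lk.
Qed.

Lemma blow_near i i' e e' : i < w.*2 -> i' < w.*2 ->
  (h i).1 = (h i').1 -> near (S * r) (h i).2 (h i').2 ->
  exists b, linked r.*2 (blow_label b i e) (blow_label b i' e').
Proof.
move=> ib i'b hB; rewrite near_next => /orP [|] nx; first exact: blow_next.
have [b lk] := blow_next e' e i'b ib (esym hB) nx.
by exists b; rewrite linked_sym.
Qed.

End BlowUp.

Section Ladder.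
Variables (w r S : nat).
Hypotheses (r_gt1 : 1 < r) (S_gt0 : 0 < S) (size_w : S * r = w.*2).

(** A block of r consecutive places, taken in both copies and closed up by the vertical edges at
its two ends, is a cycle of length r.*2. *)
Definition ladder_label (i : nat) (e : bool) : nat * nat :=
  (i %/ r, if e then r.*2 - 1 - i %% r else i %% r).

Lemma ladder_chart : chart w S r.*2 ladder_label.
Proof.
have r0 : 0 < r by lia.
split=> [|i e i' e' ib i'b|i e ib].
- by rewrite -muln2 mulnA size_w; lia.
- rewrite /ladder_label => -[eq].
  have := ltn_pmod i r0; have := ltn_pmod i' r0.
  have ei : i %% r = i' %% r -> i = i' by move=> ep; rewrite (divn_eq i r) eq ep -divn_eq.
  by case: e; case: e' => /= *; split=> //; try apply: ei; lia.
- rewrite /ladder_label /= ltn_divLR // size_w; have := ltn_pmod i r0.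
  by case: e; lia.
Qed.

Lemma ladder_rail i e : i < w.*2 -> (i %% r).+1 < r ->
  linked r.*2 (ladder_label i e) (ladder_label i.+1 e).
Proof.
move=> ib lt; have r0 : 0 < r by lia.
have lti : i.+1 < S * r.
  have := divn_eq i r; have : i %/ r < S by rewrite ltn_divLR // size_w.
  by move=> qS; have : (i %/ r).+1 * r <= S * r by [rewrite leq_mul2r qS orbT]; lia.
have nx : next_in (S * r) i i.+1 by rewrite /next_in eqxx.
have ib' : i < S * r by rewrite size_w.
rewrite /ladder_label; case: (next_step r0 ib' lti nx) lt => [|p1|p1]; try lia.
by move=> _ p1; rewrite /linked /near /=; case: e; lia.
Qed.

Lemma ladder_rung i e : (i %% r == 0) || ((i %% r).+1 == r) ->
  linked r.*2 (ladder_label i e) (ladder_label i (~~ e)).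
Proof. by rewrite /ladder_label /linked /near /=; case: e => /=; lia. Qed.

End Ladder.

(** * Turning around on the rungs of a ladder *)

(** The rungs of the ladder are numbered from 1 to w in blocks of kappa = k + 3, where the last
rung joins the positions w and 0; q is the number of the block and l < kappa the place in it.
On a rung, [b] is false on the upper rail and true on the lower rail, and [z] tells the two
copies apart: before the last rung, the edge to the previous rung belongs to B when z is true
on the upper rail, and when z is false on the lower rail.

B turns at l = 0. Its cycle number q begins at the two vertices of that rung whose edges to the
next rung are in B, goes up the ladder, turns at the first rung of the next block and comes
down. It exchanges the rails at l = k + 1, where C turns. On the other rungs one strand goes
straight through a single vertex and the other one visits the remaining three vertices. Only
the last rung of all is different: there each strand passes through one copy of w and one copy
of 0, and this shifts the places by one at the next turn, whence the test on q = 0. *)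
Definition rungB S k (b : bool) (q l : nat) (z : bool) : nat * nat :=
  if l == 0 then
    if b then if z then (q, 0) else (pred_in S q, if q == 0 then 3 * k + 6 else 3 * k + 5)
    else if z then (pred_in S q, if q == 0 then 3 * k + 5 else 3 * k + 4) else (q, 4 * k + 11)
  else if l == k.+1 then
    (q, if b then if z then 3 * k + 9 else 3 * k + 1 else if z then 3 * k + 10 else 3 * k + 2)
  else if l == k.+2 then
    (q, if q.+1 == S then
          if b then if z then 3 * k + 4 else 3 * k + 7 else if z then 3 * k + 3 else 3 * k + 8
        else
          if b then if z then 3 * k + 6 else 3 * k + 8 else if z then 3 * k + 3 else 3 * k + 7)
  else (q, if b then if z then 3 * l else 3 * l - 2 else if z then 4 * k + 11 - l else 3 * l - 1).

(** The complementary factor: C turns at l = k + 1 and exchanges the rails at l = 0. The places on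
its cycles start on the way down, one rung above the turn, so that the last rung of all, again
with two vertices on each strand, only affects the places 0 to 5. *)
Definition rungC S k (b : bool) (q l : nat) (z : bool) : nat * nat :=
  if l == 0 then
    (pred_in S q, if b then if z then 4 * k + 11 else 7 else if z then 4 * k + 10 else 6)
  else if l == k.+1 then
    if b then if z then (pred_in S q, 3 * k + 8) else (q, 3)
    else if z then (q, if q.+1 == S then 2 else 4) else (pred_in S q, 3 * k + 9)
  else if l == k.+2 then
    (q, if q.+1 == S then
          if b then if z then 0 else 5 else if z then 4 else 1
        else
          if b then if z then 2 else 0 else if z then 1 else 5)
  else (pred_in S q, if b then if z then 3 * l + 5 else 3 * l + 7
                     else if z then 3 * l + 6 else 4 * k + 10 - l).

Section Rungs.
Variables (S k : nat).
Hypothesis S_gt0 : 0 < S.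

Ltac split_ifs :=
  repeat match goal with |- context [if ?c then _ else _] => case: (boolP c) => ? end.

Ltac rung_cases l :=
  case: (eqVneq l 0) => ?; [|case: (eqVneq l k.+1) => ?; [|case: (eqVneq l k.+2) => ?]].

Lemma rungB_lt b q l z : q < S -> l < k.+3 ->
  (rungB S k b q l z).1 < S /\ (rungB S k b q l z).2 < 4 * k.+3.
Proof.
move=> qS lK; rewrite /rungB /pred_in; rung_cases l; case: b; case: z => /=.
all: by split_ifs => /=; lia.
Qed.

Lemma rungB_inj b q l z b' q' l' z' : q < S -> l < k.+3 -> q' < S -> l' < k.+3 ->
  rungB S k b q l z = rungB S k b' q' l' z' -> [/\ b = b', q = q', l = l' & z = z'].
Proof.
move=> qS lK q'S l'K e.
suff /and4P [/eqP ? /eqP ? /eqP ? /eqP ?] : [&& b == b', q == q', l == l' & z == z'] by [].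
move/eqP: e; rewrite /rungB /pred_in.
rung_cases l; rung_cases l'.
all: case: b; case: z; case: b'; case: z' => /=.
all: by rewrite ?xpair_eqE; split_ifs; rewrite ?xpair_eqE /=; lia.
Qed.

Lemma rungC_lt b q l z : q < S -> l < k.+3 ->
  (rungC S k b q l z).1 < S /\ (rungC S k b q l z).2 < 4 * k.+3.
Proof.
move=> qS lK; rewrite /rungC /pred_in; rung_cases l; case: b; case: z => /=.
all: by split_ifs => /=; lia.
Qed.

Lemma rungC_inj b q l z b' q' l' z' : q < S -> l < k.+3 -> q' < S -> l' < k.+3 ->
  rungC S k b q l z = rungC S k b' q' l' z' -> [/\ b = b', q = q', l = l' & z = z'].
Proof.
move=> qS lK q'S l'K e.
suff /and4P [/eqP ? /eqP ? /eqP ? /eqP ?] : [&& b == b', q == q', l == l' & z == z'] by [].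
move/eqP: e; rewrite /rungC /pred_in.
rung_cases l; rung_cases l'.
all: case: b; case: z; case: b'; case: z' => /=.
all: by rewrite ?xpair_eqE; split_ifs; rewrite ?xpair_eqE /=; lia.
Qed.

Ltac link_solve :=
  split_ifs; rewrite /= ?eqxx /= ?orbT //;
  first [ by apply/orP; left; lia | by apply/orP; right; lia | by exfalso; lia | lia].

Definition linkedBC b q l z b' q' l' z' :=
  linked (4 * k.+3) (rungB S k b q l z) (rungB S k b' q' l' z') ||
  linked (4 * k.+3) (rungC S k b q l z) (rungC S k b' q' l' z').

Lemma rung_linked q l z z' : q < S -> l < k.+3 -> linkedBC false q l z true q l z'.
Proof.
move=> qS lK; rewrite /linkedBC /rungB /rungC /pred_in /linked /near.
rung_cases l; case: z; case: z' => /=.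
all: link_solve.
Qed.

(** The conclusion describes how the copy in [z] changes from rung to rung: on the upper rail it
changes sign exactly at the rungs where one of the factors turns, on the lower rail always. The
step back to the first rung is excluded, and so is, on the lower rail, the step to the last
rung: position 0 is next to both rails of the first rung instead. *)
Lemma rail_linked b q l q' l' z : q < S -> l < k.+3 ->
  step k.+3 S q l q' l' -> ~~ ((l' == 0) && (q' == 0)) ->
  ~~ [&& b, l' == k.+2 & q'.+1 == S] ->
  linkedBC b q l z b q' l' (if b then ~~ z else if (l == 0) || (l == k.+1) then ~~ z else z).
Proof.
move=> qS lK; rewrite /linkedBC /rungB /rungC /pred_in /linked /near.
move=> st nz nc; case: b nc => /= nc; case: z; case: st nz nc => * ; rung_cases l => /=.
all: link_solve.
Qed.

(** The two ends of the ladder, through the last rung: from position 0 to both rails, and from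
position w to the lower rail. *)
Lemma cap_linked z :
  [/\ linkedBC true S.-1 k.+2 z false 0 0 z,
      linkedBC false S.-1 k.+2 z true S.-1 k.+1 (~~ z) &
      linkedBC true 0 0 z true S.-1 k.+2 z].
Proof.
rewrite /linkedBC /rungB /rungC /pred_in /linked /near.
case: z => /=; split.
all: link_solve.
Qed.

End Rungs.

(** * The three exceptional colours when kappa > 2 *)

(** A fixed-point free involution of the vertices, that is, a 1-factor. *)
Definition matching w (mate : nat -> bool -> nat * bool) : Prop :=
  forall i e, i < w.*2 -> [/\ (mate i e).1 < w.*2,
    mate (mate i e).1 (mate i e).2 = (i, e) & mate i e <> (i, e)].

(** Equal positions (a vertical edge), or positions joined by one of the three exceptional colours. *)
Definition core_pair w i i' :=
  [|| i == i', near w.*2 i i', i + i' == w.*2 | (i + i' == w) && ((i == 0) || (i' == 0))].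

(** The part of the graph over the three exceptional colours, together with the vertical edges, is
covered by a 1-factor, a factor of cycle length nA and two factors of cycle length nB. *)
Definition core w nA nB : Prop :=
  exists (labA : nat -> bool -> nat * nat) (labB : bool -> nat -> bool -> nat * nat)
         (mate : nat -> bool -> nat * bool),
    [/\ exists N, chart w N nA labA, forall b, exists N, chart w N nB (labB b),
        matching w mate &
        forall i e i' e', i < w.*2 -> i' < w.*2 -> (i, e) <> (i', e') -> core_pair w i i' ->
          [\/ mate i e = (i', e'), linked nA (labA i e) (labA i' e') |
              exists b, linked nB (labB b i e) (labB b i' e')]].

(** Positions 1, ..., w are the upper vertices of the rungs 1, ..., w; position 2 w - j is the
lower vertex of the rung j, and position 0 the lower vertex of the last rung. *)
Definition rung_of w i := if i == 0 then w else if i <= w then i else w.*2 - i.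
Definition lower w i := (i == 0) || (w < i).
(** The copy in which B reaches the upper vertex of the rung j from the left. It alternates along
the rail, except that it stays the same across a rung where B or C turns. *)
Definition xbit w K j := odd (w + j.+1) (+) (0 < j.-1 %% K < K.-1).
(** Turns a copy into the coordinate z of [rungB] and [rungC]. *)
Definition gauge w K i := if i == 0 then odd w else if i <= w then ~~ xbit w K i else false.

Section Core.
Variables (S k w r SA : nat).
Hypotheses (S_gt0 : 0 < S) (wE : w = S * k.+3).
Hypotheses (r_gt1 : 1 < r) (r_even : ~~ odd r) (SA_r : SA * r = w.*2).

Let w_gt2 : 2 < w. Proof. by rewrite wE; case: (S) S_gt0 => // s _; lia. Qed.

Definition rung_label (b : bool) (i : nat) (e : bool) :=
  let j := (rung_of w i).-1 in
  (if b then rungC else rungB) S k (lower w i) (j %/ k.+3) (j %% k.+3) (e (+) gauge w k.+3 i).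

Lemma rung_of_lt i : i < w.*2 ->
  ((rung_of w i).-1 %/ k.+3 < S) && ((rung_of w i).-1 %% k.+3 < k.+3).
Proof.
move=> iw; rewrite ltn_pmod // andbT ltn_divLR // -wE /rung_of.
by case: eqP => ?; [|case: ifP => ?]; lia.
Qed.

Lemma rung_of_inj i i' : i < w.*2 -> i' < w.*2 -> lower w i = lower w i' ->
  (rung_of w i).-1 = (rung_of w i').-1 -> i = i'.
Proof.
move=> iw i'w; rewrite /rung_of /lower.
by case: eqP => ?; case: (leqP i w) => ?; case: eqP => ?; case: (leqP i' w) => ?; rewrite /=; lia.
Qed.

Lemma rung_chart b : chart w S (4 * k.+3) (rung_label b).
Proof.
split=> [|i e i' e' iw i'w|i e iw]; first by rewrite wE; lia.
  have /andP [q1 l1] := rung_of_lt iw; have /andP [q2 l2] := rung_of_lt i'w.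
  have di := divn_eq (rung_of w i).-1 k.+3; have di' := divn_eq (rung_of w i').-1 k.+3.
  rewrite /rung_label => eqlab.
  suff [lo eq el ez] : [/\ lower w i = lower w i',
      (rung_of w i).-1 %/ k.+3 = (rung_of w i').-1 %/ k.+3,
      (rung_of w i).-1 %% k.+3 = (rung_of w i').-1 %% k.+3 &
      e (+) gauge w k.+3 i = e' (+) gauge w k.+3 i'].
    have ii : i = i' by apply: rung_of_inj => //; rewrite di di' eq el.
    by split=> //; move: ez; rewrite ii => /addIb.
  by case: b eqlab => /= eqlab; [apply: rungC_inj eqlab | apply: rungB_inj eqlab].
have /andP [q1 l1] := rung_of_lt iw; rewrite /rung_label.
by case: b => /=; [apply: rungC_lt | apply: rungB_lt].
Qed.

Lemma linkedBC_ex i e i' e' :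
  linkedBC S k
    (lower w i) ((rung_of w i).-1 %/ k.+3) ((rung_of w i).-1 %% k.+3) (e (+) gauge w k.+3 i)
    (lower w i') ((rung_of w i').-1 %/ k.+3) ((rung_of w i').-1 %% k.+3) (e' (+) gauge w k.+3 i') ->
  exists b, linked (4 * k.+3) (rung_label b i e) (rung_label b i' e').
Proof. by move=> /orP [l|l]; [exists false | exists true]. Qed.

Lemma xbit_step j : 0 < j ->
  xbit w k.+3 j.+1 =
    (if (j.-1 %% k.+3 == 0) || (j.-1 %% k.+3 == k.+1) then xbit w k.+3 j else ~~ xbit w k.+3 j).
Proof.
case: j => // j _; rewrite /xbit /=.
have -> : j.+1 %% k.+3 = if (j %% k.+3).+1 == k.+3 then 0 else (j %% k.+3).+1.
  rewrite -addn1 -modnDml addn1; have := ltn_pmod j (isT : 0 < k.+3).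
  by case: eqP => [->|ne] lt; rewrite ?modnn // modn_small; lia.
have := ltn_pmod j (isT : 0 < k.+3); move: (j %% k.+3) => l lk.
rewrite !addnS /=; case: (odd (w + j)) => /=.
all: case: (eqVneq l 0) => [->|l0] //=; case: (eqVneq l k.+1) => [->|l1] /=.
all: by try (case: eqP => ?); rewrite /=; lia.
Qed.

Lemma xbit1 : xbit w k.+3 1 = odd w.
Proof. by rewrite /xbit mod0n /= addnS addn1 /= negbK addbF. Qed.

Lemma last_rung d : 0 < d -> d <= k.+3 -> (w - d) %/ k.+3 = S.-1 /\ (w - d) %% k.+3 = k.+3 - d.
Proof.
move=> d0 dk; have -> : w - d = S.-1 * k.+3 + (k.+3 - d).
  by case: (S) S_gt0 wE => // s _ ->; rewrite mulSn succnK; lia.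
by rewrite divnMDl // modnMDl divn_small ?modn_small ?addn0 //; lia.
Qed.

Lemma xbit_last : xbit w k.+3 w = true.
Proof.
have [_] := @last_rung 1 isT isT; rewrite subn1 => e.
by rewrite /xbit e; lia.
Qed.

(** For even w the copies are exchanged on the edges between positions 2 w - 1 and 0. Both strands
of B have to leave position 0 in different copies, and the parity of the number of copy changes
along the ladder allows this without exchange when w is odd, and with exchange when w is even. *)
Definition twist i i' := ~~ odd w && ((i == 0) && (i'.+1 == w.*2) || (i' == 0) && (i.+1 == w.*2)).

Lemma crossed_rail i i' e : i < w.*2 -> i' < w.*2 -> next_in w.*2 i i' ->
  exists b, linked (4 * k.+3) (rung_label b i e) (rung_label b i' (~~ e (+) twist i i')).
Proof.
move=> iw i'w nx; apply: linkedBC_ex.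
have [lq1 lm1] := last_rung (isT : 0 < 1) (isT : 0 < k.+3).
have [lq2 lm2] := last_rung (isT : 0 < 2) (isT : 1 < k.+3).
have w1 : w.-1 = w - 1 by lia.
have [i0|i0] := eqVneq i 0.
  have i'1 : i' = 1 by move: nx; rewrite /next_in; lia.
  have [c _ _] := cap_linked k S_gt0 (e (+) odd w).
  rewrite i0 i'1 /lower /rung_of /gauge /twist /= xbit1 (ltnW (ltnW w_gt2)).
  rewrite w1 lq1 lm1 (_ : k.+3 - 1 = k.+2); last by lia.
  rewrite ltnNge (ltnW (ltnW w_gt2)) div0n mod0n /=.
  have -> : (2 == w.*2) = false by lia.
  have -> : ~~ e (+) ~~ odd w && false (+) ~~ odd w = e (+) odd w.
    by clear c; case: e; case: (odd w).
  exact: c.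
have [ltw|geqw] := ltnP i w.
  have i'E : i' = i.+1 by move: nx; rewrite /next_in; lia.
  rewrite i'E /lower /rung_of /gauge /twist /= (negPf i0) /= ltnNge (ltnW ltw) ltw /=.
  rewrite ltnNge ltw /= andbF addbF.
  have k0 : 0 < k.+3 by [].
  have lt1 : i.-1 < S * k.+3 by rewrite -wE; lia.
  have lt2 : i < S * k.+3 by rewrite -wE; lia.
  have nx' : next_in (S * k.+3) i.-1 i by rewrite /next_in; lia.
  have qS : i.-1 %/ k.+3 < S by rewrite ltn_divLR.
  have nz : ~~ ((i %% k.+3 == 0) && (i %/ k.+3 == 0)).
    by have := divn_eq i k.+3; move: (i %/ k.+3) (i %% k.+3) => q l; lia.
  have := @rail_linked S k S_gt0 false _ _ _ _ (e (+) ~~ xbit w k.+3 i) qS (ltn_pmod _ k0)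
    (next_step k0 lt1 lt2 nx') nz isT.
  rewrite /= xbit_step ?lt0n //.
  by case: ifP => _; case: e; case: (xbit _ _ _).
have [iw'|neqw] := eqVneq i w.
  have i'E : i' = w.+1 by move: nx; rewrite /next_in; lia.
  have [_ c _] := cap_linked k S_gt0 e.
  rewrite i'E iw' /lower /rung_of /gauge /twist /= xbit_last leqnn !ltnn ltnSn.
  have -> : (w == 0) = false by lia.
  have -> : (w.*2 - w.+1).-1 = w - 2 by lia.
  rewrite w1 lq1 lm1 lq2 lm2 (_ : k.+3 - 1 = k.+2); last by lia.
  rewrite (_ : k.+3 - 2 = k.+1); last by lia.
  by rewrite /= !andbF !addbF.
have [i2|ni2] := eqVneq i.+1 w.*2.
  have i'E : i' = 0 by move: nx; rewrite /next_in; lia.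
  have [_ _ c] := cap_linked k S_gt0 e.
  rewrite i'E /lower /rung_of /gauge /twist /= (negPf i0) i2 eqxx /=.
  have -> : w < i by lia.
  have -> : (i <= w) = false by lia.
  have -> : (w.*2 - i).-1 = 0 by lia.
  rewrite w1 lq1 lm1 (_ : k.+3 - 1 = k.+2); last by lia.
  rewrite div0n mod0n /= addbF.
  have -> : ~~ e (+) ~~ odd w && true (+) odd w = e by clear c; case: e; case: (odd w).
  exact: c.
have i'E : i' = i.+1 by move: nx; rewrite /next_in; lia.
rewrite i'E /lower /rung_of /gauge /twist /= (negPf i0) /=.
have -> : w < i by lia.
have -> : (w < i.+1) by lia.
have -> : (i <= w) = false by lia.
have -> : (i < w) = false by lia.
rewrite /= andbF !addbF.
set a := (w.*2 - i.+1).-1.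
have -> : (w.*2 - i).-1 = a.+1 by rewrite /a; lia.
have k0 : 0 < k.+3 by [].
have lt1 : a < S * k.+3 by rewrite -wE /a; lia.
have lt2 : a.+1 < S * k.+3 by rewrite -wE /a; lia.
have nx' : next_in (S * k.+3) a a.+1 by rewrite /next_in; lia.
have qS : a %/ k.+3 < S by rewrite ltn_divLR.
have nz : ~~ ((a.+1 %% k.+3 == 0) && (a.+1 %/ k.+3 == 0)).
  by have := divn_eq a.+1 k.+3; move: (a.+1 %/ k.+3) (a.+1 %% k.+3) => q l; lia.
have nc : ~~ [&& true, a.+1 %% k.+3 == k.+2 & (a.+1 %/ k.+3).+1 == S].
  apply/negP => /and3P [_ /eqP l2 /eqP q2].
  have := divn_eq a.+1 k.+3; rewrite l2.
  have : (a.+1 %/ k.+3).+1 * k.+3 = w by rewrite q2.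
  by rewrite mulSn /a; lia.
have := @rail_linked S k S_gt0 true _ _ _ _ (~~ e) qS (ltn_pmod _ k0)
    (next_step k0 lt1 lt2 nx') nz nc.
by rewrite negbK /linkedBC ![linked _ _ (_ _ _ _ _ _ e)]linked_sym.
Qed.

Lemma rung_pair i i' e e' : i < w.*2 -> i' < w.*2 -> i != i' ->
  (i + i' == w.*2) || (i + i' == w) && ((i == 0) || (i' == 0)) ->
  exists b, linked (4 * k.+3) (rung_label b i e) (rung_label b i' e').
Proof.
wlog lo : i i' e e' / ~~ lower w i => [H|] iw i'w ne sp.
  have [l|l] := boolP (lower w i); last exact: H.
  have l' : ~~ lower w i' by move: l sp ne; rewrite /lower; lia.
  have ne' : i' != i by rewrite eq_sym.
  have sp' : (i' + i == w.*2) || (i' + i == w) && ((i' == 0) || (i == 0)).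
    by rewrite addnC [(i' == 0) || _]orbC.
  have [b lk] := H i' i e' e l' i'w iw ne' sp'.
  by exists b; rewrite linked_sym.
have lo' : lower w i' by move: lo sp ne; rewrite /lower; lia.
have rr : rung_of w i = rung_of w i'.
  by move: lo sp ne; rewrite /lower /rung_of; (case: (eqVneq i 0) => ?); (case: (eqVneq i' 0) => ?);
     (case: (leqP i w) => ?); (case: (leqP i' w) => ?) => /=; lia.
have /andP [q1 l1] := rung_of_lt iw.
apply: linkedBC_ex; rewrite (negPf lo) lo' -rr; exact: rung_linked.
Qed.

(** The parallel edges between consecutive ladders and the vertical edges inside the ladders. The
pair of positions 2 w - 1 and 0 always separates two ladders, so the twist only affects this
1-factor and not the cycles of [ladder_label]. *)
Definition ladder_mate (i : nat) (e : bool) : nat * bool :=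
  if i %% r == 0 then (if i == 0 then w.*2.-1 else i.-1, e (+) (~~ odd w && (i == 0)))
  else if (i %% r).+1 == r then
    (if i.+1 == w.*2 then 0 else i.+1, e (+) (~~ odd w && (i.+1 == w.*2)))
  else (i, ~~ e).

Let r_gt0 : 0 < r. Proof. by lia. Qed.

Let mod_last : (w.*2.-1 %% r).+1 = r.
Proof. by apply: mod_pred_multiple; rewrite -?SA_r ?dvdn_mull //; lia. Qed.

Lemma ladder_matching : matching w ladder_mate.
Proof.
move=> i e iw; rewrite /ladder_mate.
case: (eqVneq (i %% r) 0) => [p0|p0] /=.
  have [i0|i0] /= := eqVneq i 0.
    have -> : (w.*2.-1 %% r == 0) = false by have := mod_last; lia.
    rewrite mod_last eqxx prednK ?eqxx ?andbT; try lia.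
    by split; [lia|rewrite -addbA addbb addbF i0|case; lia].
  have := mod_succ i.-1 r_gt0; rewrite prednK ?lt0n // p0 => s.
  have s1 : (i.-1 %% r).+1 = r by move: s; case: eqP => //; lia.
  have -> : (i.-1 %% r == 0) = false by lia.
  rewrite s1 eqxx (ltn_eqF iw) !andbF !addbF.
  by split; [lia| |case; lia].
case: (eqVneq (i %% r).+1 r) => [p1|p1] /=.
  have [i2|i2] /= := eqVneq i.+1 w.*2.
    by rewrite mod0n eqxx andbT -addbA addbb addbF -i2; split=> //; case; lia.
  rewrite (mod_succ _ r_gt0) p1 eqxx /= !andbF !addbF; split=> //; first lia.
  by case; lia.
by rewrite (negPf p0) (negPf p1) negbK; split=> //; case; case: e.
Qed.

Lemma core_ladder : core w r.*2 (4 * k.+3).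
Proof.
have SA0 : 0 < SA by case: (SA) SA_r => //; lia.
exists (ladder_label r), rung_label, ladder_mate; split.
- by exists SA; apply: ladder_chart.
- by move=> b; exists S; apply: rung_chart.
- exact: ladder_matching.
move=> i e i' e' iw i'w ne; rewrite /core_pair.
have [ii|ii] /= := eqVneq i i'.
  have ee : e' = ~~ e by case: e e' ne => -[] //; rewrite ii.
  move=> _; rewrite -ii ee.
  case J : ((i %% r == 0) || ((i %% r).+1 == r));
    first exact: Or32 (ladder_rung r_gt1 SA0 SA_r e J).
  apply: Or31; rewrite /ladder_mate; move/negbT: J; rewrite negb_or.
  by move=> /andP [/negPf -> /negPf ->].
have rail a b (f g : bool) : a < w.*2 -> b < w.*2 -> next_in w.*2 a b ->
    [\/ ladder_mate a f = (b, g), linked r.*2 (ladder_label r a f) (ladder_label r b g) |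
      exists c, linked (4 * k.+3) (rung_label c a f) (rung_label c b g)].
  (* Crossed edges, up to the twist, belong to B or C, and parallel ones to the prism. *)
  move=> aw bw nx; have [ge|ge] := eqVneq g (~~ f (+) twist a b).
    by apply: Or33; rewrite ge; apply: crossed_rail.
  have {}ge : g = f (+) twist a b by move: ge; case: g; case: (f); case: (twist a b).
  have [p1|p1] := eqVneq (a %% r).+1 r.
    apply: Or31; rewrite /ladder_mate p1 eqxx ge.
    have -> : (a %% r == 0) = false by lia.
    move: nx; rewrite /next_in /twist; have [a2|a2] := eqVneq a.+1 w.*2 => nx.
      have -> : b = 0 by lia.
      by rewrite eqxx orbT.
    have -> : b = a.+1 by lia.
    have -> : (a == 0) && (a.+2 == w.*2) = false by lia.
    by rewrite /= !andbF.
  apply: Or32; have lt : (a %% r).+1 < r by have := ltn_pmod a r_gt0; lia.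
  have a2 : a.+1 != w.*2.
    by apply: contraNneq p1 => a2; have := mod_last; rewrite -a2 /= => ->.
  have bE : b = a.+1 by move: nx; rewrite /next_in; lia.
  rewrite ge bE /twist (negPf a2) !andbF orbF.
  have -> : (a == 0) && (a.+2 == w.*2) = false by lia.
  by rewrite andbF addbF; exact: (ladder_rail r_gt1 SA0 SA_r).
rewrite near_next -orbA => /or3P [nx|nx|sp].
- exact: rail.
- have [m|l|[c l]] := rail i' i e' e i'w iw nx.
  + by apply: Or31; have [_] := ladder_matching e' i'w; rewrite m.
  + by apply: Or32; rewrite linked_sym.
  + by apply: Or33; exists c; rewrite linked_sym.
by apply: Or33; apply: rung_pair.
Qed.

End Core.

(** * The three exceptional colours when kappa = 1, and the assembly over the blow-up *)

Section CoreFour.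
Variables (w r SA : nat).
Hypotheses (w_gt1 : 1 < w) (r_gt1 : 1 < r) (r_even : ~~ odd r) (SA_r : SA * r = w.*2).

(** The number of the pair (2 j + 1, 2 j + 2) that contains the place i, cyclically. *)
Definition edge_block i := if odd i then i./2 else if i == 0 then w.-1 else i./2.-1.

(** For b true, the four edges over each rung. For b false, one square over each pair (2 j + 1, 2 j
+ 2) of consecutive places: if the pair separates two ladders, its four edges other than the
vertical ones, and otherwise its crossed edges and its two vertical edges, which leaves the
parallel edges to the ladder. *)
Definition square_label (b : bool) (i : nat) (e : bool) : nat * nat :=
  if b then
    (if i == w then 0 else if i < w then i else w.*2 - i,
     (if e then 2 else 0) + (w <= i))
  else
    let j := edge_block i in
    (j, if (j.*2.+1 %% r).+1 == r then (if e then 2 else 0) + ~~ odd i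
        else e + (if odd i then 0 else 2)).

(** The crossed edges over the pairs (2 j, 2 j + 1), which never separate two ladders because
ladders have even length. *)
Definition cross_mate (i : nat) (e : bool) : nat * bool :=
  (if odd i then i.-1 else i.+1, ~~ e).

Lemma cross_matching : matching w cross_mate.
Proof.
move=> i e iw; rewrite /cross_mate /=; case: (boolP (odd i)) => oi; split.
- by lia.
- by rewrite negbK; have -> : odd i.-1 = false by [lia]; rewrite prednK //; lia.
- by case; lia.
- by lia.
- by rewrite negbK /= oi.
- by case; lia.
Qed.

Lemma square_chart b : chart w w 4 (square_label b).
Proof.
split=> [|i e i' e' iw i'w|i e iw]; first by lia.
  rewrite /square_label /edge_block; case: b.
    case: (eqVneq i w) => ?; case: (eqVneq i' w) => ?;
    case: (ltnP i w) => ?; case: (ltnP i' w) => ?; case: e; case: e' => /eqP;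
      by rewrite xpair_eqE /= => *; split; lia.
  move=> -[eqj]; rewrite eqj; move: eqj.
  case: (boolP (odd i)) => oi; case: (boolP (odd i')) => oi';
  try (case: (eqVneq i 0) => ?); try (case: (eqVneq i' 0) => ?); case: ifP => _;
  case: e; case: e' => /= *; split; lia.
rewrite /square_label /edge_block; case: b => /=.
  by case: (eqVneq i w) => ?; case: (ltnP i w) => ?; case: e; lia.
by case: (boolP (odd i)) => ?; case: (eqVneq i 0) => ?; case: ifP => _; case: e => /=; lia.
Qed.

Let r_gt0 : 0 < r. Proof. by lia. Qed.
Let SA_gt0 : 0 < SA. Proof. by case: (SA) SA_r => //; lia. Qed.

Lemma edge_block_junction i : i < w.*2 ->
  (((edge_block i).*2.+1 %% r).+1 == r) =
    if odd i then (i %% r).+1 == r else i %% r == 0.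
Proof.
move=> iw; rewrite /edge_block; case: (boolP (odd i)) => oi.
  by have -> : (i./2).*2.+1 = i by lia.
have [->|i0] := eqVneq i 0.
  have -> : (w.-1).*2.+1 = w.*2.-1 by lia.
  by rewrite mod_pred_multiple ?mod0n ?eqxx // -SA_r ?dvdn_mull //; lia.
have -> : (i./2.-1).*2.+1 = i.-1 by lia.
have -> : i %% r = i.-1.+1 %% r by rewrite prednK // lt0n.
by rewrite mod_succ //; case: eqP.
Qed.

Lemma core_four : core w r.*2 4.
Proof.
exists (ladder_label r), square_label, cross_mate; split.
- by exists SA; apply: ladder_chart.
- by move=> b; exists w; apply: square_chart.
- exact: cross_matching.
move=> i e i' e' iw i'w ne; rewrite /core_pair.
have [ii|ii] /= := eqVneq i i'.
  have ee : e' = ~~ e by case: e e' ne => -[] //; rewrite ii.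
  move=> _; rewrite -ii ee.
  case J : (((edge_block i).*2.+1 %% r).+1 == r).
    apply: Or32; apply: (ladder_rung r_gt1 SA_gt0 SA_r).
    by move: J; rewrite edge_block_junction //; case: (odd i) => ->; rewrite ?orbT.
  apply: Or33; exists false; rewrite /square_label J /linked /near /=.
  by case: (e); case: (odd i); lia.
have rail a b (f g : bool) : a < w.*2 -> b < w.*2 -> next_in w.*2 a b ->
    [\/ cross_mate a f = (b, g), linked r.*2 (ladder_label r a f) (ladder_label r b g) |
      exists c, linked 4 (square_label c a f) (square_label c b g)].
  move=> aw bw nx; case: (boolP (odd a)) => oa; last first.
    have bE : b = a.+1 by move: nx; rewrite /next_in; lia.
    have [<-|gf] := eqVneq (~~ f) g.
      by apply: Or31; rewrite /cross_mate (negPf oa) bE.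
    have -> : g = f by case: g f gf => -[].
    apply: Or32; rewrite bE; apply: (ladder_rail r_gt1 SA_gt0 SA_r) => //.
    have := ltn_pmod a r_gt0; have := odd_mod a (negPf r_even).
    by move: r_even; move: (a %% r) => p; lia.
  have bE : edge_block b = edge_block a /\ ~~ odd b.
    by move: nx; rewrite /next_in /edge_block; case: (boolP (odd b)) => ob; case: (eqVneq b 0) => ?;
       rewrite ?oa; lia.
  case: bE => bE ob.
  case J : (((edge_block a).*2.+1 %% r).+1 == r).
    apply: Or33; exists false; rewrite /square_label bE J /linked /near /= oa (negPf ob).
    by case: (f); case: g; lia.
  have [gf|gf] := eqVneq (~~ f) g.
    apply: Or33; exists false; rewrite /square_label bE J /linked /near /= oa (negPf ob) -gf.
    by case: (f); lia.
  have -> : g = f by case: g f gf => -[].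
  have p1 : ((a %% r).+1 == r) = false by move: J; rewrite edge_block_junction // oa.
  have lt : (a %% r).+1 < r by have := ltn_pmod a r_gt0; lia.
  have a2 : a.+1 != w.*2.
    apply: contraFneq p1 => a2; have -> : a = w.*2.-1 by rewrite -a2.
    by rewrite mod_pred_multiple ?eqxx // -SA_r ?dvdn_mull //; lia.
  have -> : b = a.+1 by move: nx; rewrite /next_in; lia.
  by apply: Or32; exact: (ladder_rail r_gt1 SA_gt0 SA_r).
rewrite near_next -orbA => /or3P [nx|nx|sp].
- exact: rail.
- have [m|l|[c l]] := rail i' i e' e i'w iw nx.
  + by apply: Or31; have [_] := cross_matching e' i'w; rewrite m.
  + by apply: Or32; rewrite linked_sym.
  + by apply: Or33; exists c; rewrite linked_sym.
apply: Or33; exists true; rewrite /square_label /linked /near /=.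
case: (eqVneq i w) => ?; case: (eqVneq i' w) => ?; case: (ltnP i w) => ?; case: (ltnP i' w) => ?;
case: (e); case: (e') => /=; lia.
Qed.

End CoreFour.

(** K_{4w} minus a 1-factor splits into 2 w - 1 cycle factors: one factor indexed by [None], and w
- 1 pairs of factors. *)
Definition decomposable w (len : option (bool * 'I_w.-1) -> nat) : Prop :=
  exists (lab : option (bool * 'I_w.-1) -> nat -> bool -> nat * nat)
         (mate : nat -> bool -> nat * bool),
    [/\ forall j, exists N, chart w N (len j) (lab j), matching w mate &
        forall i e i' e', i < w.*2 -> i' < w.*2 -> (i, e) <> (i', e') ->
          mate i e = (i', e') \/ exists j, linked (len j) (lab j i e) (lab j i' e')].

(** The pair number 0 is the one over the exceptional colours, and the pair number s > 0 is the
blow-up of the colours 2 s and 2 s + 1. *)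
Lemma decomposable_of_core w nA nB (r : 'I_w.-1 -> nat) : 1 < w -> core w nA nB ->
  (forall s, [/\ 1 < r s, ~~ odd (r s) & r s %| w.*2]) ->
  decomposable (fun j => if j is Some (_, s) then if s == 0 :> nat then nB else (r s).*2 else nA).
Proof.
move=> w2 [labA [labB [mate [chA chB mt cov]]]] rP.
pose h s i := (0, zigzag w s (elt w i)).
pose lab j := if j is Some (b, s) then
    if (s : 'I_w.-1) == 0 :> nat then labB b
    else blow_label (r s) (w.*2 %/ r s) (h s) b else labA.
have hP (s : 'I_w.-1) : [/\ 0 < w.*2 %/ r s, 1 * (w.*2 %/ r s * r s) = w.*2,
    forall i i', i < w.*2 -> i' < w.*2 -> h s i = h s i' -> i = i' &
    forall i, i < w.*2 -> (h s i).1 < 1 /\ (h s i).2 < w.*2 %/ r s * r s].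
  have [r1 _ rd] := rP s; have sw : s < w by have := ltn_ord s; lia.
  split.
  - by rewrite divn_gt0; [apply: dvdn_leq => //; lia | lia].
  - by rewrite mul1n divnK.
  - move=> i i' iw i'w [e]; apply: (elt_inj w2 iw i'w).
    exact: (zigzag_inj w2 sw (elt_lt w2 iw) (elt_lt w2 i'w) e).
  - by move=> i iw; rewrite divnK //; split=> //; apply: zigzag_lt => //; apply: elt_lt.
exists lab, mate; split=> //.
  case=> [[b s]|] //=; case: eqP => // _.
  have [r1 re rd] := rP s; have [S0 hs hi hl] := hP s.
  by eexists; apply: (blow_chart re r1 S0 hs hi hl).
move=> i e i' e' iw i'w ne; case: (boolP (core_pair w i i')) => [sp|nsp].
  have := cov i e i' e' iw i'w ne sp.
  case=> [?|l|[b l]]; [by left | by right; exists None |].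
  have w0 : 0 < w.-1 by lia.
  by right; exists (Some (b, Ordinal w0)).
right; have ii : i != i' by apply: contra nsp => /eqP ->; rewrite /core_pair eqxx.
have ne' : elt w i != elt w i' by apply: contra ii => /eqP /(elt_inj w2 iw i'w) ->.
have [c cN col] := colour_ex w2 (elt_lt w2 iw) (elt_lt w2 i'w) ne'.
(* The colours 0, 1 and 2 w - 2, the last one standing for -1, are the exceptional ones. *)
have c2 : 1 < c < w.*2 - 2.
  have : ~~ [|| c == 0, c == 1 | c == w.*2 - 2].
    apply: contra nsp => sp; have := special_pair w2 iw i'w ii sp col.
    by rewrite /core_pair => ->; rewrite orbT.
  by lia.
have sw : c./2 < w.-1 by lia.
pose s := Ordinal sw; have [r1 re rd] := rP s; have [S0 hs hi hl] := hP s.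
have s0 : (s == 0 :> nat) = false by rewrite /=; lia.
have nr : near (w.*2 %/ r s * r s) (h s i).2 (h s i').2.
  rewrite divnK // /h /= near_next.
  have cE : c./2.*2 + odd c = c by lia.
  have sw' : c./2 < w by lia.
  have := @zigzag_next w c./2 (odd c) _ _ w2 sw' (elt_lt w2 iw) (elt_lt w2 i'w) ne'.
  rewrite cE => /(_ cN col).
  by case/orP => /andP [-> _]; rewrite ?orbT.
have [b lk] := blow_near re r1 S0 hs hl e e' iw i'w erefl nr.
by exists (Some (b, s)); rewrite /lab s0.
Qed.

Lemma HWP_of_decomposable w m n (ty : option (bool * 'I_w.-1) -> bool) :
  1 < w -> 2 < m -> 2 < n -> m %| 4 * w -> n %| 4 * w ->
  decomposable (fun j => if ty j then m else n) ->
  HWP (4 * w) m n (#|[set j | ty j]|, #|[set j | ~~ ty j]|).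
Proof.
move=> w2 m2 n2 md nd [lab [mate [ch mt cov]]].
pose T := ('I_w.*2 * bool)%type.
have cT : #|{: T}| = 4 * w by rewrite card_prod card_ord card_bool; lia.
pose labT j (x : T) := lab j x.1 x.2.
pose mateT (x : T) : T := (insubd x.1 (mate x.1 x.2).1, (mate x.1 x.2).2).
have mateE x : (nat_of_ord (mateT x).1, (mateT x).2) = mate x.1 x.2.
  have [lt _ _] := mt x.1 x.2 (ltn_ord _).
  by rewrite /mateT /= val_insubd lt -surjective_pairing.
have eqT (x y : T) : (nat_of_ord x.1, x.2) = (nat_of_ord y.1, y.2) -> x = y.
  by case: x y => [a e] [b f] /= [/ord_inj -> ->].
rewrite -cT; apply: (@HWP_of_labellings T _ ty m n labT mateT) => //.
- by rewrite cT.
- by rewrite cT.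
- by rewrite cT card_option card_prod card_bool card_ord; lia.
- move=> j; have [N [sz inj bd]] := ch j; split.
  + move=> [a e] [b f] eq.
    have [/ord_inj /= -> /= ->] // := inj _ _ _ _ (ltn_ord a) (ltn_ord b) eq.
  + move=> x; have [lt _] := bd x.1 x.2 (ltn_ord _).
    have n0 : 0 < (if ty j then m else n) by case: (ty j); lia.
    by rewrite cT -sz mulnK.
  + by move=> x; have [] := bd x.1 x.2 (ltn_ord _).
- move=> x; have [_ mK _] := mt x.1 x.2 (ltn_ord _).
  by apply: eqT; rewrite mateE; move: mK; rewrite -[mate x.1 x.2]mateE.
- move=> x; have [_ _ mn] := mt x.1 x.2 (ltn_ord _).
  by apply/eqP => e; apply: mn; rewrite -mateE e.
- move=> x y xy; have [|m1|[j lk]] := cov x.1 x.2 y.1 y.2 (ltn_ord _) (ltn_ord _).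
  + by move=> /eqT e; rewrite e eqxx in xy.
  + by apply/orP; left; apply/eqP; apply: eqT; rewrite mateE.
  + by apply/orP; right; apply/existsP; exists j.
Qed.

(** * All factors but one are octagons *)

Section AllOctagons.
Variables (h w r SA : nat).
Hypotheses (wE : w = h.*2) (h_gt1 : 1 < h).
Hypotheses (r_gt1 : 1 < r) (r_even : ~~ odd r) (SA_r : SA * r = w.*2).

(** The positions 0, ..., 2 w - 1 now run twice through the Hamilton cycle formed by the colours 0
and 1 of a tournament of w players, so that each player owns two opposite positions, and
[unzigzag] gives the player at a place of that cycle. A pair of players carries four pairs of
positions, so that a colour c > 1 gives a factor of 4-cycles of positions ([colour_pos]). The
cycle D of positions takes half of the pairs over the colours 0 and 1; the others are used by
[square_pos] and [octagon]. *)
Definition unzigzag p :=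
  if p == 0 then w.-1 else if p == 1 then 0 else if odd p then w.-1 - p./2 else p./2.

Lemma unzigzag_lt p : p < w -> unzigzag p < w.
Proof.
rewrite /unzigzag => pw.
by case: (eqVneq p 0) => ?; case: (eqVneq p 1) => ?; case: (boolP (odd p)) => ?; lia.
Qed.

Lemma unzigzagK p : p < w -> zigzag h 0 (unzigzag p) = p.
Proof.
rewrite /zigzag /unzigzag -wE /= subn0 => pw.
case: (eqVneq p 0) => [->|p0]; first by rewrite eqxx.
case: (eqVneq p 1) => [->|p1]; first by case: eqP => //; lia.
case: (boolP (odd p)) => op; (case: eqP => ?; first by lia); (case: eqP => ?; first by lia).
  by case: ifP; lia.
by case: ifP; lia.
Qed.

Definition residue i := if i < w then i else i - w.
Definition second_lap i := w <= i.

Definition point i := unzigzag (residue i).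

(** The place on its octagon of the vertex in copy e of one of the positions x, y, z, t, which are
coded by (u, l) = (false, false), (false, true), (true, false), (true, true). The pairs xy and
zt are opposite edges of D over the colour 1, and x y z t is a 4-cycle of positions. Its four
pairs of positions can be split into two octagons by running twice around the 4-cycle, parallel
along xy, yz, tx and crossed along zt for b = false, and complementarily for b = true.

If xy does not separate two ladders, its parallel edges are needed by the ladder. The first
octagon traverses them in the same direction, so that it remains a single octagon when they are
replaced with the vertical edges at x and y. The second octagon does the same for zt. Here [jn]
says that the pair concerned, xy for b = false and zt for b = true, does separate ladders. *)
Definition octagon (b jn u l e : bool) : nat :=
  match b, u, l, e with
  | false, false, false, false => 0
  | false, false, false, true => if jn then 4 else 1
  | false, false, true, false => if jn then 1 else 4
  | false, false, true, true => 5
  | false, true, false, false => if jn then 2 else 3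
  | false, true, false, true => 6
  | false, true, true, false => 7
  | false, true, true, true => if jn then 3 else 2
  | true, false, false, false => 0
  | true, false, false, true => if jn then 4 else 5
  | true, false, true, false => if jn then 5 else 4
  | true, false, true, true => 1
  | true, true, false, false => 2
  | true, true, false, true => if jn then 6 else 3
  | true, true, true, false => if jn then 3 else 6
  | true, true, true, true => 7
  end.

Definition junction B := (B.*2.+1 %% r).+1 == r.
Definition low_block i := let B := edge_block w i in if B < h then B else B - h.

Definition octagon_label (b : bool) (i : nat) (e : bool) : nat * nat :=
  (low_block i,
   octagon b (junction (if b then low_block i + h else low_block i))
           (h <= edge_block w i) (~~ odd i) e).

(** The pairs of opposite positions, and the pairs of colour 0 that are not edges of D, form
4-cycles. *)
Definition square_pos i : nat * nat :=
  ((residue i)./2, if odd i then if second_lap i then 1 else 2 else if second_lap i then 3 else 0).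

(** Shifting the places by one for odd colours turns the pairs of the colour into (2 j, 2 j + 1). *)
Definition shifted (d : bool) k := if d then if k.+1 == w then 0 else k.+1 else k.

Lemma shifted_next d k k' : k < w -> k' < w -> next_in w k k' -> odd k == d ->
  ~~ odd (shifted d k) /\ shifted d k' = (shifted d k).+1.
Proof.
move=> kw k'w nx /eqP <-; rewrite /shifted.
case/orP: nx => [/eqP e|/andP [/eqP e /eqP e']]; rewrite ?e ?e'.
  by case: (boolP (odd k)) => ok; [rewrite ifF ?ifF|]; lia.
by have -> : odd k; [lia | rewrite eqxx; case: eqP; lia].
Qed.

(** The four positions owned by two players of a pair of colour c, in cyclic order. *)
Definition colour_pos c i : nat * nat :=
  let k := zigzag h c./2 (point i) in
  let k' := shifted (odd c) k in
  (k'./2, odd k' + if second_lap i then 2 else 0).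

Lemma octagon_inj b jn u l e u' l' e' :
  octagon b jn u l e = octagon b jn u' l' e' -> [/\ u = u', l = l' & e = e'].
Proof. by case: b; case: jn; case: u; case: l; case: e; case: u'; case: l'; case: e'. Qed.

Lemma edge_block_inj i i' : i < w.*2 -> i' < w.*2 ->
  edge_block w i = edge_block w i' -> odd i = odd i' -> i = i'.
Proof.
move=> iw i'w; rewrite /edge_block.
by case: (eqVneq i 0) => ?; case: (eqVneq i' 0) => ?; case: ifP; case: ifP; lia.
Qed.

Lemma edge_block_lt i : i < w.*2 -> edge_block w i < w.
Proof. by rewrite /edge_block => iw; case: ifP => ?; [|case: eqP => ?]; lia. Qed.

Lemma octagon_chart b : chart w h 8 (octagon_label b).
Proof.
split=> [|i e i' e' iw i'w|i e iw]; first by lia.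
  rewrite /octagon_label => -[jj]; rewrite jj => /octagon_inj [uu ll ->]; split=> //.
  apply: edge_block_inj => //; last by apply: negb_inj.
  move: jj uu; rewrite /low_block /=; move: (edge_block w i) (edge_block w i') => B B'.
  by case: ltnP => ?; case: ltnP => ?; lia.
split.
  rewrite /octagon_label /low_block /=; have := edge_block_lt iw.
  by case: (ltnP (edge_block w i) h); lia.
rewrite /octagon_label /=; move: (junction _) (h <= _) (~~ _) => jn u l.
by case: b; case: jn; case: u; case: l; case: e.
Qed.

Lemma residue_lt i : i < w.*2 -> residue i < w.
Proof. by rewrite /residue; case: (ltnP i w); lia. Qed.

Lemma residue_inj i i' : residue i = residue i' -> second_lap i = second_lap i' -> i = i'.
Proof. by rewrite /residue /second_lap; case: (ltnP i w); case: (ltnP i' w); lia. Qed.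

Lemma odd_residue i : odd (residue i) = odd i.
Proof. by rewrite /residue; case: (ltnP i w); lia. Qed.

Lemma square_pos_inj i i' : square_pos i = square_pos i' -> i = i'.
Proof.
rewrite /square_pos => -[p q]; apply: residue_inj.
  have := odd_residue i; have := odd_residue i'; move: q.
  by case: (odd i); case: (odd i'); case: (second_lap i); case: (second_lap i') => //; lia.
by move: q; case: (odd i); case: (odd i'); case: (second_lap i); case: (second_lap i').
Qed.

Lemma square_pos_lt i : i < w.*2 -> (square_pos i).1 < h /\ (square_pos i).2 < 1 * 4.
Proof.
move=> /residue_lt; rewrite /square_pos /= => lt; split; first by lia.
by case: (odd i); case: (second_lap i).
Qed.

Lemma point_lt i : i < w.*2 -> point i < w.
Proof. by move=> /residue_lt /unzigzag_lt. Qed.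

Lemma point_lt' i : i < w.*2 -> point i < h.*2.
Proof. by rewrite -wE; apply: point_lt. Qed.

Lemma point_inj i i' : i < w.*2 -> i' < w.*2 -> point i = point i' -> residue i = residue i'.
Proof.
by move=> iw i'w /(congr1 (zigzag h 0)); rewrite !unzigzagK // residue_lt.
Qed.

Lemma colour_pos_inj c i i' : c < w.-1 -> i < w.*2 -> i' < w.*2 ->
  colour_pos c i = colour_pos c i' -> i = i'.
Proof.
move=> cw iw i'w; rewrite /colour_pos /shifted => -[p q].
have ch : c./2 < h by lia.
have lt := zigzag_lt h_gt1 ch (point_lt' iw); have lt' := zigzag_lt h_gt1 ch (point_lt' i'w).
have [kk uu] : zigzag h c./2 (point i) = zigzag h c./2 (point i') /\ second_lap i = second_lap i'.
  move: p q lt lt'; rewrite -wE; move: (zigzag _ _ _) (zigzag _ _ _) => k k'.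
  case: (odd c); case: (second_lap i); case: (second_lap i'); try (case: (eqVneq k.+1 w) => ?);
  try (case: (eqVneq k'.+1 w) => ?); rewrite /=; split; lia.
apply: residue_inj uu; apply: point_inj => //.
exact: (zigzag_inj h_gt1 ch (point_lt' iw) (point_lt' i'w) kk).
Qed.

Lemma colour_pos_lt c i : c < w.-1 -> i < w.*2 ->
  (colour_pos c i).1 < h /\ (colour_pos c i).2 < 1 * 4.
Proof.
move=> cw iw; have ch : c./2 < h by lia.
have := zigzag_lt h_gt1 ch (point_lt' iw); rewrite /colour_pos /shifted.
move: (zigzag _ _ _) => k; move=> lt.
by case: (odd c); case: (second_lap i) => /=; try (case: eqP => ?); split; lia.
Qed.

(** The next place on the cycle of players belongs to two positions; b is the one that does not
follow a on D. *)
Lemma opposite_next a b : a < w.*2 -> b < w.*2 ->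
  next_in w (residue a) (residue b) -> ~~ next_in w.*2 a b ->
  [\/ a.+1 < w /\ b = a.+1 + w, a.+1 = w /\ b = 0 | w <= a /\ b = a.+1 - w].
Proof.
rewrite /next_in /residue => aw bw.
case: (ltnP a w) => la; case: (ltnP b w) => lb /orP [/eqP e|/andP [/eqP e /eqP e0]] no.
- by exfalso; lia.
- by constructor 2.
- by constructor 1; lia.
- by exfalso; lia.
- by constructor 3; lia.
- by exfalso; lia.
- by exfalso; lia.
- by constructor 3; lia.
Qed.

Lemma opposite_block a b : a < w.*2 -> b < w.*2 -> odd a -> ~~ odd b ->
  next_in w (residue a) (residue b) -> ~~ next_in w.*2 a b ->
  low_block b = low_block a /\ (h <= edge_block w b) = ~~ (h <= edge_block w a).
Proof.
move=> aw bw oa ob nx no.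
have [ea eb] : edge_block w a = a./2 /\
    edge_block w b = if a./2 < h then a./2 + h else a./2 - h.
  rewrite /edge_block oa (negPf ob); split=> //.
  case: (opposite_next aw bw nx no) => -[la ->] {nx no bw ob};
    case: (ltnP a./2 h) => l2; try (case: eqP => e0); lia.
rewrite /low_block ea eb /= => {nx no bw ob ea eb}.
have : a./2 < w by lia.
move: (a./2) => B lt; case: (ltnP B h) => lB; case: ltnP => lB'; lia.
Qed.

Let r_gt0 : 0 < r. Proof. by lia. Qed.
Let w_gt1 : 1 < w. Proof. by lia. Qed.
Let SA_gt0 : 0 < SA. Proof. by case: (SA) SA_r => //; lia. Qed.

Lemma decomposable_octagons :
  decomposable (fun j : option (bool * 'I_w.-1) => if j is Some _ then 8 else r.*2).
Proof.
pose lab (j : option (bool * 'I_w.-1)) := if j is Some (b, s) then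
    if s == 0 :> nat then octagon_label b
    else blow_label 4 1 (if s == 1 :> nat then square_pos else colour_pos s) b
  else ladder_label r.
have hP (s : 'I_w.-1) (g := if s == 1 :> nat then square_pos else colour_pos s) :
   (forall i i', i < w.*2 -> i' < w.*2 -> g i = g i' -> i = i') /\
   (forall i, i < w.*2 -> (g i).1 < h /\ (g i).2 < 1 * 4).
  rewrite /g; case: eqP => _; split=> [i i' iw i'w|i iw].
  - exact: square_pos_inj.
  - exact: square_pos_lt.
  - by apply: colour_pos_inj.
  - by apply: colour_pos_lt.
have sz : h * (1 * 4) = w.*2 by lia.
exists lab, cross_mate; split.
- case=> [[b s]|]; last by exists SA; apply: (ladder_chart r_gt1 SA_gt0 SA_r).
  rewrite /lab; case: eqP => _; first by exists h; apply: octagon_chart.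
  have [hi hl] := hP s.
  by exists (h * 1); apply: (@blow_chart w 4 1 h _ isT isT isT sz hi hl).
- exact: (cross_matching w_gt1 r_gt1 r_even SA_r).
have w0 : 0 < w.-1 by lia.
have w1' : 1 < w.-1 by lia.
have oct b i e i' e' : linked 8 (octagon_label b i e) (octagon_label b i' e') ->
    exists j, linked (if j is Some _ then 8 else r.*2) (lab j i e) (lab j i' e').
  by move=> lk; exists (Some (b, Ordinal w0)).
have blow (s : 'I_w.-1) (g := if s == 1 :> nat then square_pos else colour_pos s) i e i' e' :
    s != 0 :> nat -> i < w.*2 -> i' < w.*2 -> (g i).1 = (g i').1 -> near 4 (g i).2 (g i').2 ->
    exists j, linked (if j is Some _ then 8 else r.*2) (lab j i e) (lab j i' e').
  move=> s0 iw i'w g1 g2; have [hi hl] := hP s.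
  have [b lk] := @blow_near w 4 1 h _ isT isT isT sz hl i i' e e' iw i'w g1 g2.
  by exists (Some (b, s)); rewrite /lab (negPf s0).
have rail a b (f g : bool) : a < w.*2 -> b < w.*2 -> next_in w (residue a) (residue b) ->
    cross_mate a f = (b, g) \/
    exists j, linked (if j is Some _ then 8 else r.*2) (lab j a f) (lab j b g).
  move=> aw bw nx; have oa := odd_residue a; have ob := odd_residue b.
  case: (boolP (odd a)) => pa; last first.
    have hb : residue b = (residue a).+1.
      by move: nx; rewrite /next_in; have := residue_lt aw; rewrite (negPf pa) in oa; lia.
    have [ab|ab] := eqVneq (second_lap a) (second_lap b); last first.
      right; apply: (@blow (Ordinal w1') a f b g isT aw bw); rewrite /= /square_pos.
        by rewrite hb /=; lia.
      have -> : odd b by rewrite -ob hb /= oa.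
      by rewrite (negPf pa); case: (second_lap a) ab; case: (second_lap b).
    have bE : b = a.+1.
      by move: hb ab; rewrite /residue /second_lap; case: (ltnP a w); case: (ltnP b w); lia.
    have [<-|gf] := eqVneq (~~ f) g; first by left; rewrite /cross_mate (negPf pa) bE.
    have -> : g = f by case: g f gf => -[].
    right; exists None; rewrite bE; apply: (ladder_rail r_gt1 SA_gt0 SA_r) => //.
    have := ltn_pmod a r_gt0; have := odd_mod a (negPf r_even).
    by move: r_even pa; move: (a %% r) => p; lia.
  have pb : ~~ odd b by move: nx oa ob; rewrite /next_in pa; lia.
  have [nx2|nx2] := boolP (next_in w.*2 a b); last first.
    right; apply: (@oct (f != g)).
    have [lo up] := opposite_block aw bw pa pb nx nx2.
    rewrite /octagon_label lo up pa pb /linked eqxx /=; move: (junction _) (h <= _) => jn u.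
    by case: (f); case: (g); case: jn; case: u.
  have eb : edge_block w b = edge_block w a.
    move: nx2; rewrite /next_in /edge_block pa (negPf pb) => /orP [/eqP e|/andP [/eqP e /eqP ->]].
      by rewrite e /=; lia.
    by rewrite /=; lia.
  have lo : low_block b = low_block a by rewrite /low_block eb.
  have [gf|gf] := eqVneq (~~ f) g.
    right; apply: (@oct (~~ (h <= edge_block w a))).
    rewrite /octagon_label lo eb pa pb /linked eqxx -gf /=.
    move: (h <= edge_block w a) => u; move: (junction _) => jn.
    by case: (f); case: jn; case: u.
  have -> : g = f by case: g f gf => -[].
  case J : (junction (edge_block w a)).
    right; apply: (@oct (h <= edge_block w a)).
    have jj : junction (if h <= edge_block w a then low_block a + h else low_block a) = true.
      by rewrite -{}J /low_block /=; congr junction; case: ltnP; lia.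
    rewrite /octagon_label lo eb jj pa pb /linked eqxx /=; move: (h <= _) => u.
    by case: (f); case: u.
  have jE := edge_block_junction w_gt1 r_gt1 r_even SA_r aw.
  have p1 : ((a %% r).+1 == r) = false by move: J; rewrite /junction jE pa.
  have lt : (a %% r).+1 < r by rewrite ltn_neqAle p1 ltn_pmod.
  have a2 : (a.+1 == w.*2) = false.
    apply: contraFF p1 => /eqP a2; have -> : a = w.*2.-1 by rewrite -a2.
    by rewrite mod_pred_multiple ?eqxx // ?double_gt0 ?(ltnW w_gt1) // -SA_r dvdn_mull.
  have -> : b = a.+1 by move: nx2; rewrite /next_in a2 orbF => /eqP.
  by right; exists None; apply: (ladder_rail r_gt1 SA_gt0 SA_r).
move=> i e i' e' iw i'w ne.
have [hh|hh] := eqVneq (residue i) (residue i').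
  right; have [ii|ii] := eqVneq i i'.
    have ee : e' = ~~ e by case: e e' ne => -[] //; rewrite ii.
    rewrite -ii ee; case J : (junction (edge_block w i)).
      exists None; apply: (ladder_rung r_gt1 SA_gt0 SA_r).
      move: J; rewrite /junction (edge_block_junction w_gt1 r_gt1 r_even SA_r iw).
      by case: (odd i) => ->; rewrite ?orbT.
    apply: (@oct (h <= edge_block w i)).
    have jj : junction (if h <= edge_block w i then low_block i + h else low_block i) = false.
      by rewrite -{}J /low_block /=; congr junction; case: ltnP; lia.
    rewrite /octagon_label jj /linked eqxx /=; move: (h <= _) (odd i) => u l.
    by case: (e); case: u; case: l.
  have uu : second_lap i != second_lap i' by apply: contra ii => /eqP uu; apply/eqP/residue_inj.
  apply: (@blow (Ordinal w1') i e i' e' isT iw i'w); rewrite /= /square_pos /= ?hh //.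
  rewrite -[odd i]odd_residue hh odd_residue.
  by case: (odd i'); case: (second_lap i) uu; case: (second_lap i').
have pp : point i != point i' by apply: contra hh => /eqP /(point_inj iw i'w) ->.
have pi : point i < h.*2 by rewrite -wE point_lt.
have pi' : point i' < h.*2 by rewrite -wE point_lt.
have [c cN col] := colour_ex h_gt1 pi pi' pp.
have cE : c./2.*2 + odd c = c by lia.
have ch : c./2 < h by lia.
have := @zigzag_next h c./2 (odd c) _ _ h_gt1 ch pi pi' pp.
rewrite cE => /(_ cN col); rewrite -wE in cN *.
have [c2|c2] := ltnP 1 c.
  have cw : c < w.-1 by lia.
  have c1 : (c == 1) = false by lia.
  have lt := zigzag_lt h_gt1 ch pi; have lt' := zigzag_lt h_gt1 ch pi'; rewrite -wE in lt lt'.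
  move=> zz; right; have c0 : Ordinal cw != 0 :> nat by rewrite /=; lia.
  have [g1 g2] : (colour_pos c i).1 = (colour_pos c i').1 /\
      near 4 (colour_pos c i).2 (colour_pos c i').2.
    have one k k' g g' : ~~ odd k -> k' = k.+1 -> let f (x : bool) := if x then 2 else 0 in
        [/\ k./2 = k'./2, near 4 (odd k + f g) (odd k' + f g') &
            near 4 (odd k' + f g') (odd k + f g)].
      move=> ok -> /=; have ok' := negPf ok; rewrite uphalf_half ok' /=.
      by case: (g); case: (g').
    rewrite /colour_pos; case/orP: zz => /andP [nx od].
      have [ok kk] := shifted_next lt lt' nx od.
      by have [] := one _ _ (second_lap i) (second_lap i') ok kk.
    have [ok kk] := shifted_next lt' lt nx od.
    by have [-> _ nn] := one _ _ (second_lap i') (second_lap i) ok kk.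
  by apply: (@blow (Ordinal cw) i e i' e' c0 iw i'w); rewrite /= c1.
have -> : c./2 = 0 by lia.
rewrite !unzigzagK ?residue_lt // => /orP [] /andP [nx _]; first exact: rail.
have [m|[j lk]] := rail i' i e' e i'w iw nx; [left|right].
  by have [_] := cross_matching w_gt1 r_gt1 r_even SA_r e' i'w; rewrite m.
by exists j; rewrite linked_sym.
Qed.

End AllOctagons.

(** * Eight vertices, and counting types *)

(** The graph left on 8 vertices by [ladder_label] and [cross_mate] is a union of two Hamilton
cycles; the vertex (i, e) is coded by 2 i + e. *)
Definition eight_cycle (r : nat) (b : bool) : seq nat :=
  if b then [:: 0; 4; 1; 5; 2; 6; 3; 7]
  else if r == 2 then [:: 0; 6; 1; 7; 2; 4; 3; 5] else [:: 0; 6; 1; 7; 2; 3; 4; 5].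

Definition eight_label r b (i : nat) (e : bool) : nat * nat :=
  (0, index (i.*2 + e) (eight_cycle r b)).

Lemma core_two r : (r == 2) || (r == 4) -> core 2 r.*2 8.
Proof.
move=> r24.
have r1 : 1 < r by lia.
have re : ~~ odd r by case/orP: r24 => /eqP ->.
have sz : 4 %/ r * r = 2.*2 by case/orP: r24 => /eqP ->.
have S0 : 0 < 4 %/ r by case/orP: r24 => /eqP ->.
have small i e : i < 4 -> i.*2 + nat_of_bool e \in iota 0 8.
  by rewrite mem_iota; case: e; lia.
have perm b : perm_eq (eight_cycle r b) (iota 0 8) by case/orP: r24 => /eqP ->; case: b.
exists (ladder_label r), (eight_label r), cross_mate; split.
- by exists (4 %/ r); apply: (ladder_chart r1 S0 sz).
- move=> b; exists 1; split=> // [i e i' e' iw i'w [eqi]|i e iw].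
    have mem j f : j < 4 -> j.*2 + nat_of_bool f \in eight_cycle r b.
      by move=> j4; rewrite (perm_mem (perm b)) small.
    have : i.*2 + e = i'.*2 + e'.
      by rewrite -(nth_index 0 (mem i e iw)) eqi nth_index // mem.
    by case: (e); case: (e') => /= ?; split; lia.
  by rewrite /= -[8](perm_size (perm b)) index_mem (perm_mem (perm b)) small.
- exact: (@cross_matching 2 r (4 %/ r) isT r1 re sz).
move=> i e i' e' iw i'w ne _.
have [c|[c|c]] : cross_mate i e = (i', e') \/
   linked r.*2 (ladder_label r i e) (ladder_label r i' e') \/
   [exists b, linked 8 (eight_label r b i e) (eight_label r b i' e')].
- suff : [|| cross_mate i e == (i', e'), linked r.*2 (ladder_label r i e) (ladder_label r i' e') |
     linked 8 (eight_label r true i e) (eight_label r true i' e') ||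
     linked 8 (eight_label r false i e) (eight_label r false i' e')].
    case/or3P => [/eqP ->|->|/orP c]; [by left|by right; left|right; right].
    by apply/existsP; case: c => lk; [exists true|exists false].
  have {}ne : (i, e) != (i', e') by apply/eqP.
  by case/orP: r24 ne => /eqP -> {re sz S0 small perm r1};
     move: i i' iw i'w => [|[|[|[|i]]]] [|[|[|[|i']]]] //= _ _; case: e; case: e'.
- exact: Or31.
- exact: Or32.
- by case/existsP: c => b lk; apply: Or33; exists b.
Qed.

Lemma card_some_types w (tA : bool) (tp : 'I_w -> bool) (ty : option (bool * 'I_w) -> bool) :
  ty None = tA -> (forall b s, ty (Some (b, s)) = tp s) ->
  #|[set j | ty j]| = tA + #|[set s | tp s]|.*2.
Proof.
move=> tN tS; pose S := [set s | tp s].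
have -> : [set j | ty j] = (if tA then [set None] else set0) :|:
    Some @: setX setT S.
  apply/setP => -[[b s]|]; rewrite !inE ?tN ?tS.
    rewrite (_ : (Some (b, s) \in _) = false) /=; last by case: (tA); rewrite inE.
    apply/idP/imsetP => [ts|[[b' s']]]; first by exists (b, s); rewrite ?inE.
    by rewrite !inE /= => ts [_ ->].
  case: (tA); rewrite !inE ?eqxx //=.
  by apply/esym/negbTE/imsetP => -[].
rewrite cardsU (_ : _ :&: _ = set0) ?cards0 ?subn0.
  rewrite card_imset => [|x y [] //]; rewrite cardsX cardsT card_bool mul2n.
  by case: (tA); rewrite ?cards1 ?cards0.
apply/setP => j; rewrite !inE; apply/negP => /andP [h /imsetP [x _ e]].
by move: h; rewrite e; case: (tA); rewrite inE.
Qed.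

(** * Choosing the types *)

Lemma decomposable_ext w (len len' : option (bool * 'I_w.-1) -> nat) :
  len =1 len' -> decomposable len -> decomposable len'.
Proof.
move=> e [lab [mate [ch mt cov]]]; exists lab, mate; split=> // [j|i f i' f' iw i'w ne].
  by rewrite -e.
by have [?|[j lk]] := cov i f i' f' iw i'w ne; [left | right; exists j; rewrite -e].
Qed.

Lemma card_ord_lt n a : a <= n -> #|[set s : 'I_n | s < a]| = a.
Proof.
move=> an; rewrite -sum1dep_card (big_ord_narrow an) sum_nat_const card_ord muln1 //.
Qed.

Lemma core_exists w r K : 2 < K \/ K = 1 -> K %| w -> 1 < w -> 1 < r -> ~~ odd r -> r %| w.*2 ->
  core w r.*2 (4 * K).
Proof.
move=> K13 Kw w1 r1 re rw; have rS : w.*2 %/ r * r = w.*2 by rewrite divnK.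
case: K13 => [K3|->]; last exact: (core_four w1 r1 re rS).
have [k kE] : exists k, K = k.+3 by exists (K - 3); lia.
rewrite kE in Kw *.
apply: (@core_ladder (w %/ k.+3) k w r (w.*2 %/ r)) => //; last by rewrite divnK.
by rewrite divn_gt0 // dvdn_leq //; lia.
Qed.

Lemma double_predn x : 0 < x -> x.*2.-1 = (2 * x.-1).+1.
Proof. by case: x => // x _; rewrite mul2n. Qed.

Section Assembly.
Variables (k t w alpha beta : nat).
Hypotheses (k_gt0 : 0 < k) (t_gt1 : 1 < t) (w_gt0 : 0 < w) (ktw : k * t %| w).
Hypothesis total : alpha + beta = w.*2.-1.

Let m := 4 * k.
Let n := 4 * k * t.
Let a := alpha./2.

Let kw : k %| w. Proof. exact: dvdn_trans (dvdn_mulr _ _) ktw. Qed.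
Let kt_le : k * t <= w. Proof. exact: dvdn_leq. Qed.
Let kt_gt1 : 1 < k * t.
Proof. by apply: leq_trans t_gt1 _; rewrite leq_pmull. Qed.
Let k_eq1 : k * t = 2 -> k = 1.
Proof.
case: (k) k_gt0 => [|[|x]] // _ e.
by have := leq_mul (isT : 2 <= x.+2) t_gt1; rewrite e.
Qed.
Let w_gt1 : 1 < w. Proof. exact: leq_trans kt_le. Qed.
Let m_dvd : m %| 4 * w. Proof. exact: dvdn_mul. Qed.
Let n_dvd : n %| 4 * w. Proof. by rewrite /n -mulnA dvdn_mul. Qed.

Let m_gt2 : 2 < m. Proof. exact: leq_mul (isT : 3 <= 4) k_gt0. Qed.
Let n_gt2 : 2 < n. Proof. exact: leq_mul m_gt2 (ltnW t_gt1). Qed.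
Let a_le : a <= w.-1.
Proof.
have := half_leq (leq_addr beta alpha); rewrite total double_predn // mul2n.
by rewrite -[_.+1]/(true + _) half_bit_double.
Qed.

(** Half of the length of the cycles of type c, so that a block of this many positions, blown up,
makes one cycle. *)
Definition half_length (c : bool) := (if c then k else k * t).*2.

Lemma half_lengthP c : [/\ 1 < half_length c, ~~ odd (half_length c) & half_length c %| w.*2].
Proof.
have dbl x : 0 < x -> 1 < x.*2 by case: x.
rewrite /half_length; split.
- by apply: dbl; case: c => //; apply: ltnW kt_gt1.
- by rewrite odd_double.
by rewrite -!muln2 dvdn_pmul2r //; case: c.
Qed.

Lemma half_lengthE c : (half_length c).*2 = if c then m else n.
Proof. by rewrite /half_length /m /n; case: c; lia. Qed.

Lemma HWP_of_types (tp : 'I_w.-1 -> bool) :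
  #|[set s | tp s]| = a ->
  decomposable (fun j => if j is Some (_, s) then (half_length (tp s)).*2
                         else (half_length (odd alpha)).*2) ->
  HWP (4 * w) m n (alpha, beta).
Proof.
move=> ca dec; pose ty (j : option (bool * 'I_w.-1)) :=
  if j is Some (_, s) then tp s else odd alpha.
have cT : #|[set j | ty j]| = alpha.
  by rewrite (@card_some_types _ (odd alpha) tp) // ca odd_double_half.
have cF : #|[set j | ~~ ty j]| = beta.
  have -> : [set j | ~~ ty j] = ~: [set j | ty j] by apply/setP => j; rewrite !inE.
  rewrite cardsCs setCK cT card_option card_prod card_bool card_ord.
  by rewrite -(double_predn w_gt0) -total addKn.
rewrite -cT -cF; apply: HWP_of_decomposable => //.
apply: decomposable_ext dec => -[[b s]|]; exact: half_lengthE.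
Qed.

(** One pair of factors of type c is prescribed by the exceptional colours, and the other pairs of
factors are free; the parity of alpha decides on the type of the single factor. *)
Lemma HWP_core (c : bool) (K := if c then k else k * t) :
  (2 < K \/ K = 1) -> (if c then 0 < a else a < w.-1) -> HWP (4 * w) m n (alpha, beta).
Proof.
move=> K13 ca; have aw := a_le.
pose tp (s : 'I_w.-1) := if c then s < a else w.-1 - a <= s.
apply: (@HWP_of_types tp).
  rewrite /tp; case: c @K K13 ca tp => K K13 ca tp; first exact: card_ord_lt.
  have -> : [set s : 'I_w.-1 | w.-1 - a <= s] = ~: [set s : 'I_w.-1 | s < w.-1 - a].
    by apply/setP => s; rewrite !inE leqNgt.
  by rewrite cardsCs setCK card_ord card_ord_lt ?leq_subr // subKn.
have [r1 re rd] := half_lengthP (odd alpha).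
have Kw : K %| w by rewrite /K; case: (c).
have := decomposable_of_core w_gt1 (core_exists K13 Kw w_gt1 r1 re rd)
  (fun s => half_lengthP (tp s)).
apply: decomposable_ext => -[[b s]|] //=; case: eqP => // s0.
have -> : tp s = c by rewrite /tp s0 leqn0 subn_eq0; case: (c) ca => [->|lt] //; rewrite leqNgt lt.
by rewrite half_lengthE /K /m /n; case: (c); rewrite ?mulnA.
Qed.

(** All w - 1 pairs consist of octagons, and only the single factor may have the other type. *)
Lemma HWP_octagons (c : bool) : (if c then k else k * t) = 2 ->
  a = (if c then w.-1 else 0) -> HWP (4 * w) m n (alpha, beta).
Proof.
move=> K2 ac; have [r1 re rd] := half_lengthP (odd alpha).
have hl : (half_length c).*2 = 8 by rewrite /half_length K2.
apply: (@HWP_of_types (fun=> c)).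
  rewrite ac; case: (c); last by apply/eqP; rewrite cards_eq0; apply/eqP/setP => s; rewrite !inE.
  by rewrite -[RHS]card_ord -cardsT; congr #|pred_of_set _|; apply/setP => s; rewrite !inE.
have w2 : 2 %| w by rewrite -K2; case: (c).
have rS : w.*2 %/ half_length (odd alpha) * half_length (odd alpha) = w.*2 by rewrite divnK.
have [wE|wn] := eqVneq w 2; last first.
  have wh : w = (w./2).*2 by rewrite even_halfK // -dvdn2.
  have h1 : 1 < w./2 by move: w_gt1 wn; rewrite {1 2}wh; case: (w./2) => [|[|]].
  by apply: decomposable_ext (decomposable_octagons wh h1 r1 re rS) => -[[b s]|].
have r24 : (half_length (odd alpha) == 2) || (half_length (odd alpha) == 4).
  move: kt_le kt_gt1; rewrite wE => le2 gt2; have kt2 : k * t = 2 by apply/eqP; rewrite eqn_leq le2.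
  have k1 := k_eq1 kt2.
  by rewrite /half_length kt2 k1; case: (odd alpha).
have := core_two r24; rewrite -{1}wE => core2.
have := decomposable_of_core w_gt1 core2 (fun s => half_lengthP c).
apply: decomposable_ext => -[[b s]|] //=; case: eqP => //= _; by rewrite hl.
Qed.

(** A pair of C_n-factors can be prescribed when it is wanted and k t > 2, and a pair of
C_m-factors when it is wanted and k <> 2. Otherwise all pairs are octagons. *)
Lemma HWP_exists : HWP (4 * w) m n (alpha, beta).
Proof.
have aw := a_le.
have [lt|ge] := ltnP a w.-1; last first.
  have aE : a = w.-1 by apply/eqP; rewrite eqn_leq aw.
  have [k2|k2] := eqVneq k 2; first exact: (@HWP_octagons true).
  by apply: (@HWP_core true) => /=; lia.
have [kt3|kt2] := ltnP 2 (k * t); first by apply: (@HWP_core false) => //; left.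
have ktE : k * t = 2 by lia.
have k1 := k_eq1 ktE.
have [a0|a0] := posnP a; first exact: (@HWP_octagons false).
by apply: (@HWP_core true) => //; right.
Qed.

End Assembly.

Theorem theorem1p5 (k t v : nat) (hk : 1 <= k) (ht : 2 <= t) (hv : 0 < v)
    (hmod : v = 0 %[mod 4 * k * t]) (alpha beta : nat) :
  HWP v (4 * k) (4 * k * t) (alpha, beta) <-> alpha + beta = (v - 2) %/ 2.
Proof.
have : 4 * (k * t) %| v by rewrite mulnA /dvdn hmod mod0n.
case/dvdnP => s vE; have {}vE : v = 4 * (k * t * s) by rewrite vE; lia.
set w := k * t * s in vE.
have w0 : 0 < w by lia.
split=> [|tot]; first by apply: HWP_count; lia.
rewrite vE; apply: HWP_exists => //; first exact: dvdn_mulr.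
by lia.
Qed.
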